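(* Let $X$ be either $\mathbb{E}^d$ or $\mathbb{H}^d$, let $K\subset X$ be a body, and let $n\ge 1$ be an integer. Then $K$ admits both an $n$-saturated packing of $X$ with replicas of $K$ and an $n$-reduced covering of $X$ with replicas of $K$.
   Context: $\mathbb{E}^d$ is $d$-dimensional Euclidean space and $\mathbb{H}^d$ is $d$-dimensional hyperbolic space. A body is a nonempty compact connected set which is the closure of its interior. A replica of $K$ is a set congruent to $K$, i.e. the image of $K$ under an isometry of the space. A packing is a family of sets whose interiors are mutually disjoint; a covering is a family of sets whose union is the whole space. A packing with replicas of $K$ is $n$-saturated if no $n-1$ members of it can be replaced with $n$ replicas of $K$ (i.e. one cannot delete $n-1$ members and add $n$ replicas of $K$ so that the result is again a packing). A covering with replicas of $K$ is $n$-reduced if no $n$ members of it can be replaced by $n-1$ replicas of $K$ without uncovering a portion of the space (i.e. one cannot delete $n$ members and add $n-1$ replicas of $K$ so that the result is again a covering). *)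

(* Defs.v *)
From HB Require Import structures.
From mathcomp Require Import all_boot all_order all_algebra.
From mathcomp Require Import ring lra.
From mathcomp Require Import all_classical all_reals all_analysis.

Set Implicit Arguments.
Unset Strict Implicit.
Unset Printing Implicit Defensive.

Import Order.TTheory GRing.Theory Num.Theory.

Local Open Scope classical_set_scope.
Local Open Scope ring_scope.

Section DotProduct.
Context {R : realType}.

Definition dot (d : nat) (u v : 'rV[R]_d) : R := \sum_(i < d) u 0 i * v 0 i.

Lemma dotC d (u v : 'rV[R]_d) : dot u v = dot v u.
Proof. by apply: eq_bigr => i _; rewrite mulrC. Qed.

Lemma dotDl d (u v w : 'rV[R]_d) : dot (u + v) w = dot u w + dot v w.
Proof.
by rewrite /dot -big_split /=; apply: eq_bigr => i _; rewrite mxE mulrDl.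
Qed.

Lemma dotZl d (t : R) (u w : 'rV[R]_d) : dot (t *: u) w = t * dot u w.
Proof.
by rewrite /dot mulr_sumr; apply: eq_bigr => i _; rewrite mxE mulrA.
Qed.

Lemma dotDr d (u v w : 'rV[R]_d) : dot w (u + v) = dot w u + dot w v.
Proof. by rewrite dotC dotDl !(dotC w). Qed.

Lemma dotZr d (t : R) (u w : 'rV[R]_d) : dot w (t *: u) = t * dot w u.
Proof. by rewrite dotC dotZl (dotC w). Qed.

Lemma dotNl d (u w : 'rV[R]_d) : dot (- u) w = - dot u w.
Proof. by rewrite -scaleN1r dotZl mulN1r. Qed.

Lemma dotNr d (u w : 'rV[R]_d) : dot w (- u) = - dot w u.
Proof. by rewrite dotC dotNl dotC. Qed.

Definition dotE := (dotDl, dotDr, dotZl, dotZr, dotNl, dotNr).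

Lemma dot_ge0 d (u : 'rV[R]_d) : 0 <= dot u u.
Proof. by apply: sumr_ge0 => i _; rewrite -expr2 sqr_ge0. Qed.

Lemma dot_eq0 d (u : 'rV[R]_d) : dot u u = 0 -> u = 0.
Proof.
move=> /eqP; rewrite psumr_eq0; last by move=> i _; rewrite -expr2 sqr_ge0.
move=> /allP u0; apply/rowP => i; rewrite mxE.
have := u0 i (mem_index_enum i).
by rewrite /= mulf_eq0 orbb => /eqP.
Qed.

Lemma discr_le (a b c : R) :
  (forall t, 0 <= a + 2 * t * b + t ^+ 2 * c) -> b ^+ 2 <= a * c.
Proof.
move=> h.
have [c0|c0] := eqVneq c 0.
  have [b0|b0] := eqVneq b 0; first by rewrite c0 b0 mulr0 expr0n.
  have := h (- (a + 1) / (2 * b)); rewrite c0 mulr0 addr0.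
  have -> : a + 2 * (- (a + 1) / (2 * b)) * b = - 1 by field.
  by rewrite oppr_ge0 ler10.
have cge0 : 0 <= c.
  rewrite leNgt; apply/negP => clt0.
  pose s : R := 1 - (`|a| + 2 * `|b|) / c.
  have s1 : 1 <= s.
    rewrite /s lerDl oppr_ge0; apply: mulr_ge0_le0.
      by rewrite addr_ge0 ?mulr_ge0.
    by rewrite invr_le0 ltW.
  have sc : s * c = c - (`|a| + 2 * `|b|) by rewrite /s; field.
  have ssc : s ^+ 2 * c = s * (s * c) by rewrite mulrA.
  have := h s; rewrite ssc sc => hs.
  have := ler_norm a; have := ler_norm b; have := normr_ge0 a => a0 hb ha.
  nra.
have cgt0 : 0 < c by rewrite lt_neqAle eq_sym c0.
have := h (- b / c).
have -> : a + 2 * (- b / c) * b + (- b / c) ^+ 2 * c = (a * c - b ^+ 2) / c.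
  by field.
by rewrite pmulr_lge0 ?invr_gt0// subr_ge0.
Qed.

Lemma dot_CS d (u v : 'rV[R]_d) : dot u v ^+ 2 <= dot u u * dot v v.
Proof.
apply: discr_le => t.
have := dot_ge0 (u + t *: v); rewrite !dotE (dotC v u).
by congr (0 <= _); ring.
Qed.

End DotProduct.

(* ['rV[R]_d] carries the sup-distance in the library; the alias [euclidean]
   carries the Euclidean one instead. *)
Section Euclidean.
Context {R : realType} {d : nat}.

Definition euclidean : Type := 'rV[R]_d.

HB.instance Definition _ := Choice.on euclidean.

Definition eudist (x y : euclidean) : R := Num.sqrt (dot (x - y) (x - y)).

Lemma eudistxx x : eudist x x = 0.
Proof. by rewrite /eudist subrr -(scale0r 0) dotZl mul0r sqrtr0. Qed.

Lemma eudist_positivity x y : eudist x y = 0 -> x = y.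
Proof.
move=> /eqP; rewrite sqrtr_eq0 => h.
apply/eqP; rewrite -subr_eq0; apply/eqP/dot_eq0/eqP.
by rewrite eq_le h dot_ge0.
Qed.

Lemma eudist_sym x y : eudist x y = eudist y x.
Proof. by rewrite /eudist -opprB dotNl dotNr opprK. Qed.

Lemma eudist_triangle y x z : eudist x z <= eudist x y + eudist y z.
Proof.
rewrite /eudist.
have -> : x - z = (x - y) + (y - z) by rewrite addrA subrK.
move: (x - y) (y - z) => u v.
rewrite -[leRHS]ger0_norm ?addr_ge0 ?sqrtr_ge0// -sqrtr_sqr.
rewrite ler_wsqrtr// sqrrD !sqr_sqrtr ?dot_ge0// !dotE (dotC v u).
have : dot u v <= Num.sqrt (dot u u) * Num.sqrt (dot v v).
  rewrite -sqrtrM ?dot_ge0// (le_trans (ler_norm _))// -sqrtr_sqr.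
  by rewrite ler_wsqrtr// dot_CS.
by move: (Num.sqrt _ * _) => s h; lra.
Qed.

HB.instance Definition _ := isMetric.Build R euclidean
  eudistxx eudist_positivity eudist_sym eudist_triangle.

End Euclidean.
Arguments euclidean : clear implicits.

Section Hyperbolic.
Context {R : realType} {d : nat}.

Definition lorentz (p q : R * 'rV[R]_d) : R := dot p.2 q.2 - p.1 * q.1.

(* Hyperboloid model: the upper sheet of [lorentz p p = -1]. *)
Record hyperbolic : Type := Hyperbolic {
  hpoint : R * 'rV[R]_d ;
  _ : (lorentz hpoint hpoint == -1) && (0 < hpoint.1) }.

HB.instance Definition _ := [isSub for hpoint].
HB.instance Definition _ := [Choice of hyperbolic by <:].

(* Inverse of the hyperbolic cosine on [1, +oo[ *)
Definition arcosh (t : R) : R := ln (t + Num.sqrt (t ^+ 2 - 1)).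

Definition hdist (x y : hyperbolic) : R :=
  arcosh (- lorentz (hpoint x) (hpoint y)).

Lemma lorentzC p q : lorentz p q = lorentz q p.
Proof. by rewrite /lorentz dotC mulrC. Qed.

Lemma hyperbolicP (x : hyperbolic) :
  dot (hpoint x).2 (hpoint x).2 = (hpoint x).1 ^+ 2 - 1 /\ 0 < (hpoint x).1.
Proof.
case: x => p /= /andP[/eqP]; rewrite /lorentz => h ->; split=> //.
by rewrite expr2; lra.
Qed.

Lemma lorentz_ge1 (x y : hyperbolic) : 1 <= - lorentz (hpoint x) (hpoint y).
Proof.
have [] := hyperbolicP x; have [] := hyperbolicP y; rewrite /lorentz.
case: (hpoint x) (hpoint y) => [a u] [b v] /= hv b0 hu a0.
have := dot_CS u v; rewrite hu hv.
have := dot_ge0 (u - v); rewrite !dotE hu hv (dotC v u).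
move: (dot u v) => w h1 h2.
have ab0 : 0 < a * b by rewrite mulr_gt0.
rewrite leNgt; apply/negP => h.
have : (1 + w) ^+ 2 <= (a * b) ^+ 2.
  by rewrite exprMn; move: h2 h1; rewrite !expr2 => h2 h1; nra.
by rewrite ler_sqr ?nnegrE; lra.
Qed.

Lemma arcosh_arg_ge1 (c : R) : 1 <= c -> 1 <= c + Num.sqrt (c ^+ 2 - 1).
Proof. by move=> c1; rewrite (le_trans c1)// lerDl sqrtr_ge0. Qed.

Lemma hdistxx x : hdist x x = 0.
Proof.
case: x => p /= h; rewrite /hdist /arcosh /=.
by case/andP: h => /eqP -> _; rewrite opprK expr1n subrr sqrtr0 addr0 ln1.
Qed.

Lemma hdist_positivity x y : hdist x y = 0 -> x = y.
Proof.
rewrite /hdist /arcosh => /eqP.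
have c1 := lorentz_ge1 x y; have := arcosh_arg_ge1 c1 => e1.
rewrite ln_eq0 ?(lt_le_trans _ e1)// => /eqP.
have := sqrtr_ge0 ((- lorentz (hpoint x) (hpoint y)) ^+ 2 - 1) => s0 h.
have {s0 c1 e1 h} : - lorentz (hpoint x) (hpoint y) = 1 by lra.
have [] := hyperbolicP x; have [] := hyperbolicP y; rewrite /lorentz => hv b0 hu a0 h.
apply: val_inj => /=; move: hv b0 hu a0 h.
case: (hpoint x) (hpoint y) => [a u] [b v] /= hv b0 hu a0 h.
have w : dot u v = a * b - 1 by lra.
have := dot_CS u v; rewrite hu hv w => cs.
have uv : u = v.
  apply/eqP; rewrite -subr_eq0; apply/eqP/dot_eq0/eqP.
  rewrite eq_le dot_ge0 andbT !dotE (dotC v u) hu hv w.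
  by move: cs; rewrite !expr2; nra.
congr pair => //; move: hu; rewrite uv hv => /eqP.
rewrite (inj_eq (addIr _)) eqrXn2 ?ltW// => /eqP -> //.
Qed.

Lemma hdist_sym x y : hdist x y = hdist y x.
Proof. by rewrite /hdist lorentzC. Qed.

Lemma lorentz_orthogonal_ge0 (p : R * 'rV[R]_d) (y : hyperbolic) :
  lorentz p (hpoint y) = 0 -> 0 <= lorentz p p.
Proof.
have [] := hyperbolicP y; rewrite /lorentz.
case: p (hpoint y) => [a u] [b v] /= hv b0 h.
have := dot_CS u v; rewrite hv.
have -> : dot u v = a * b by lra.
have := dot_ge0 u; move: (dot u u) => w w0 hw.
have h2 : (a * a) * (b * b) <= w * (b * b) by move: hw; rewrite !expr2; lra.
by rewrite subr_ge0; move: h2; rewrite ler_pM2r// mulr_gt0.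
Qed.

Lemma lorentz_CS (x y z : hyperbolic)
    (a := - lorentz (hpoint x) (hpoint y))
    (b := - lorentz (hpoint y) (hpoint z))
    (c := - lorentz (hpoint x) (hpoint z)) :
  (c - a * b) ^+ 2 <= (a ^+ 2 - 1) * (b ^+ 2 - 1).
Proof.
have -> : (c - a * b) ^+ 2 = (a * b - c) ^+ 2 by ring.
apply: discr_le => t.
pose p : R * 'rV[R]_d := (
  (hpoint x).1 - a * (hpoint y).1 + t * ((hpoint z).1 - b * (hpoint y).1),
  (hpoint x).2 - a *: (hpoint y).2 + t *: ((hpoint z).2 - b *: (hpoint y).2)).
have [hx _] := hyperbolicP x; have [hy _] := hyperbolicP y.
have [hz _] := hyperbolicP z.
have hxy : dot (hpoint x).2 (hpoint y).2 = (hpoint x).1 * (hpoint y).1 - a.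
  by rewrite /a /lorentz; ring.
have hyz : dot (hpoint y).2 (hpoint z).2 = (hpoint y).1 * (hpoint z).1 - b.
  by rewrite /b /lorentz; ring.
have hxz : dot (hpoint x).2 (hpoint z).2 = (hpoint x).1 * (hpoint z).1 - c.
  by rewrite /c /lorentz; ring.
have := @lorentz_orthogonal_ge0 p y.
rewrite /lorentz /= !dotE (dotC (hpoint y).2 (hpoint x).2).
rewrite (dotC (hpoint z).2 (hpoint y).2) (dotC (hpoint z).2 (hpoint x).2).
rewrite hx hy hz hxy hyz hxz => h.
have {h} : 0 <= _ := h ltac:(ring).
by congr (0 <= _); ring.
Qed.

Lemma hdist_triangle y x z : hdist x z <= hdist x y + hdist y z.
Proof.
rewrite /hdist.
have a1 := lorentz_ge1 x y; have b1 := lorentz_ge1 y z.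
have c1 := lorentz_ge1 x z; have cs := lorentz_CS x y z.
cbv zeta in cs; move: a1 b1 c1 cs.
move: (- lorentz (hpoint x) (hpoint y)) (- lorentz (hpoint y) (hpoint z)) => a b.
move: (- lorentz _ _) => c a1 b1 c1 cs.
have a0 : 0 <= a ^+ 2 - 1 by rewrite subr_ge0 expr_ge1 ?(le_trans ler01).
have b0 : 0 <= b ^+ 2 - 1 by rewrite subr_ge0 expr_ge1 ?(le_trans ler01).
have ea := arcosh_arg_ge1 a1; have eb := arcosh_arg_ge1 b1.
have ec := arcosh_arg_ge1 c1.
rewrite /arcosh -lnM ?posrE ?(lt_le_trans ltr01)//.
rewrite ler_ln ?posrE ?mulr_gt0 ?(lt_le_trans ltr01)//.
set s := Num.sqrt (a ^+ 2 - 1); set r := Num.sqrt (b ^+ 2 - 1).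
have s0 : 0 <= s by exact: sqrtr_ge0.
have r0 : 0 <= r by exact: sqrtr_ge0.
have hs : s ^+ 2 = a ^+ 2 - 1 by rewrite sqr_sqrtr.
have hr : r ^+ 2 = b ^+ 2 - 1 by rewrite sqr_sqrtr.
have cm : c <= a * b + s * r.
  rewrite -lerBlDl (le_trans (ler_norm _))// -sqrtr_sqr.
  rewrite -[leRHS]ger0_norm ?mulr_ge0// -[leRHS]sqrtr_sqr.
  by rewrite ler_wsqrtr// exprMn hs hr.
have -> : (a + s) * (b + r) = (a * b + s * r) + (a * r + b * s) by ring.
apply: lerD => //.
have q0 : 0 <= a * r + b * s by rewrite addr_ge0// mulr_ge0// (le_trans ler01).
rewrite -[leRHS]ger0_norm// -[leRHS]sqrtr_sqr ler_wsqrtr//.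
have -> : (a * r + b * s) ^+ 2 = (a * b + s * r) ^+ 2 - 1.
  have -> : (a * r + b * s) ^+ 2
    = a ^+ 2 * r ^+ 2 + b ^+ 2 * s ^+ 2 + 2 * (a * b * s * r) by ring.
  have -> : (a * b + s * r) ^+ 2
    = a ^+ 2 * b ^+ 2 + s ^+ 2 * r ^+ 2 + 2 * (a * b * s * r) by ring.
  by rewrite hs hr; ring.
have c0 := le_trans ler01 c1.
by rewrite lerD2r ler_sqr ?nnegrE// (le_trans c0).
Qed.

HB.instance Definition _ := isMetric.Build R hyperbolic
  hdistxx hdist_positivity hdist_sym hdist_triangle.

End Hyperbolic.
Arguments hyperbolic : clear implicits.

Section PackingCovering.
Context {R : realType} {X : metricType R}.

Definition metric_isometry (f : X -> X) : Prop :=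
  bijective f /\ forall x y, mdist (f x) (f y) = mdist x y.

Definition body (K : set X) : Prop :=
  [/\ K !=set0, compact K, connected K & closure (interior K) = K].

Definition replica (K A : set X) : Prop :=
  exists2 f : X -> X, metric_isometry f & A = f @` K.

(* Families are indexed, so repeated members count with multiplicity. *)
Definition packing_with (K : set X) (I : Type) (F : I -> set X) : Prop :=
  (forall i, replica K (F i)) /\ trivIset [set: I] (fun i => interior (F i)).

Definition covering_with (K : set X) (I : Type) (F : I -> set X) : Prop :=
  (forall i, replica K (F i)) /\ \bigcup_i F i = [set: X].

Definition exchange (I : Type) (F : I -> set X) (D : set I)
    (J : Type) (G : J -> set X) (k : {i : I | ~ D i} + J) : set X :=
  match k with
  | inl i => F (proj1_sig i)
  | inr j => G j
  end.
Arguments exchange {I} F D {J} G k.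

Definition n_saturated (n : nat) (K : set X) (I : Type) (F : I -> set X) :
    Prop :=
  ~ exists (D : set I) (G : 'I_n -> set X),
      (D #= `I_(n - 1))%card /\ packing_with K (exchange F D G).

Definition n_reduced (n : nat) (K : set X) (I : Type) (F : I -> set X) :
    Prop :=
  ~ exists (D : set I) (G : 'I_(n - 1) -> set X),
      (D #= `I_n)%card /\ covering_with K (exchange F D G).

End PackingCovering.

(* Main.v *)
(* A group of isometries that is cocompact and moves every point by more than D
   lets one work as in a compact quotient: among the invariant packings take one
   with the largest number of orbits, among the invariant coverings one with the
   smallest. Suppose an exchange contradicts n-saturation (resp. n-reducedness).
   Some connected component of the intersection graph of the old and new members
   already has more new than old members (resp. fewer); its diameter is at most
   (2n - 1) diam K, so if D exceeds this bound all translates of the component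
   can be exchanged simultaneously, which changes the number of orbits.

   In E^d the group m Z^d has the required properties. In H^d we use congruence
   subgroups of the integral isometries of - sqrt 2 x_0^2 + x_1^2 + ... + x_d^2
   over Z[sqrt 2]. The conjugate form is definite, so the conjugate of such an
   isometry g is orthogonal; if g moves some point little and is 1 mod m with m
   large, the norm of the trace of (g - 1) / m is an integer of absolute value
   less than 1, hence the conjugate of g has maximal trace and g is trivial. For cocompactness, a point p of H^d
   turns Z[sqrt 2]^(1+d) into a Euclidean lattice whose nonzero vectors, and
   those of its dual, are bounded below, hence it has a basis of bounded length.
   The Gram matrices of these bases, and the bases mod m, take finitely many
   values, and two points with the same values are related by an element of the
   congruence subgroup up to a bounded distance. *)

Require Import Defs.
From HB Require Import structures.
From mathcomp Require Import all_boot all_order all_algebra.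
From mathcomp Require Import zify ring lra.
From mathcomp Require Import all_classical all_reals all_analysis.

Set Implicit Arguments.
Unset Strict Implicit.
Unset Printing Implicit Defensive.

Import Order.TTheory GRing.Theory Num.Theory.

Local Open Scope classical_set_scope.
Local Open Scope ring_scope.

(** * Lattice reduction *)

Section LatticeReduction.
Context {R : realType}.

Local Notation toR := (map_mx (intr : int -> R)).

Lemma dot_mxE k (u v : 'rV[R]_k) : dot u v = (u *m v^T) 0 0.
Proof. by rewrite mxE; apply: eq_bigr => i _; rewrite mxE. Qed.

(** Cauchy-Schwarz applies in each column, and the squared column norms of [W] add up to its squared
    row norms. *)
Lemma dot_mulmx_le k M (r : 'rV[R]_k) (W : 'M[R]_(k, M)) (c : R) :
  (forall i, `|r 0 i| <= 1) -> (forall i, dot (row i W) (row i W) <= c) ->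
  dot (r *m W) (r *m W) <= k%:R * (k%:R * c).
Proof.
move=> r1 Wc.
have rr : dot r r <= k%:R.
  rewrite -[k in leRHS]card_ord -sumr_const; apply: ler_sum => i _.
  by rewrite -expr2 -real_normK ?num_real// expr_le1.
apply: (@le_trans _ _ (\sum_j (dot r r * dot (col j W)^T (col j W)^T))).
  apply: ler_sum => j _; rewrite -expr2.
  have -> : (r *m W) 0 j = dot r (col j W)^T.
    by rewrite mxE; apply: eq_bigr => i _; rewrite !mxE.
  exact: dot_CS.
rewrite -mulr_sumr; apply: ler_pM => //; first exact: dot_ge0.
  by apply: sumr_ge0 => j _; exact: dot_ge0.
rewrite exchange_big /= -[k in leRHS]card_ord mulr_natl -sumr_const.
apply: ler_sum => i _; apply: le_trans (Wc i).
by apply: ler_sum => j _; rewrite !mxE.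
Qed.

Lemma dot_add_le k (u v : 'rV[R]_k) :
  dot (u + v) (u + v) <= 2 * (dot u u + dot v v).
Proof. by have := dot_ge0 (u - v); rewrite !dotE (dotC v u); lra. Qed.

(* The Smith normal form of a nonzero row vector exhibits it as an integer
   multiple of the first row of a unimodular matrix. *)
Lemma int_row_primitive k (y : 'rV[int]_(1 + k)) : y != 0 ->
  exists2 V : 'M[int]_(1 + k), V \in unitmx &
    exists2 s : int, s != 0 & y = s *: row 0 V.
Proof.
move=> y0; have [L _ [V uV [e _ yE]]] := int_Smith_normal_form y.
exists V => //; exists (L 0 0 * e`_0).
  apply: contra_neq y0 => s0; rewrite yE.
  apply/rowP => j; rewrite mxE big1 ?mxE// => i _; rewrite mxE big_ord1 mxE.
  have [i0|] := eqVneq (0 : nat) i; last by rewrite mulr0n mulr0 mul0r.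
  by rewrite mulr1n s0 mul0r.
rewrite {1}yE; apply/rowP => j; rewrite !mxE (bigD1 0)//= big1 ?addr0.
  by rewrite mxE big_ord1 mxE mulr1n.
move=> i i0; rewrite mxE big_ord1 mxE.
have -> : ((0 : 'I_1) == i :> nat) = false by rewrite eq_sym; exact: negbTE i0.
by rewrite mulr0n mulr0 mul0r.
Qed.

Lemma unit_toR k (U : 'M[int]_k) : U \in unitmx -> toR U \in unitmx.
Proof.
move=> uU; suff: toR U *m toR (invmx U) = 1%:M by move/mulmx1_unit => [].
by rewrite -map_mxM mulmxV// map_mx1.
Qed.

(* [B] and [D] are dual bases of a lattice and of its dual. *)
Definition short_basis k := forall c : R, 0 < c -> exists C : R,
  forall M (D B : 'M[R]_(k, M)) (A : 'M[R]_k),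
  B *m D^T = 1%:M -> D = A *m B ->
  (forall y : 'rV[int]_k, y != 0 -> c <= dot (toR y *m D) (toR y *m D)) ->
  exists2 U : 'M[int]_k, U \in unitmx &
    forall i, dot (row i (toR U *m B)) (row i (toR U *m B)) <= C.

(* [D1] is an almost shortest vector of the dual lattice, so projecting the
   other dual vectors along it shortens them by a bounded factor only. *)
Lemma short_basis_step k (c C : R) M (D1 B1 : 'rV[R]_M) (D2 B2 : 'M[R]_(k, M))
    (A : 'M[R]_(1 + k)) :
  0 < c ->
  (forall (D B : 'M[R]_(k, M)) (A : 'M[R]_k),
    B *m D^T = 1%:M -> D = A *m B ->
    (forall y : 'rV[int]_k, y != 0 ->
       c / 2 <= dot (toR y *m D) (toR y *m D)) ->
    exists2 U : 'M[int]_k, U \in unitmx &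
      forall i, dot (row i (toR U *m B)) (row i (toR U *m B)) <= C) ->
  let D := col_mx D1 D2 in let B := col_mx B1 B2 in
  B *m D^T = 1%:M -> D = A *m B ->
  (forall y : 'rV[int]_(1 + k), y != 0 ->
    c <= dot (toR y *m D) (toR y *m D)) ->
  (forall y : 'rV[int]_(1 + k), y != 0 ->
    dot D1 D1 - c / 10 <= dot (toR y *m D) (toR y *m D)) ->
  exists2 U : 'M[int]_(1 + k), U \in unitmx &
    forall i, dot (row i (toR U *m B)) (row i (toR U *m B)) <=
      Num.max C (2 * (1 / c + k%:R * (k%:R * C))).
Proof.
move=> c0 IH D B BD DA cD aD.
pose a := dot D1 D1.
have ca : c <= a.
  have := cD (row_mx 1%:M 0); rewrite map_row_mx map_mx1 map_mx0 mul_row_col.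
  rewrite mul1mx mul0mx addr0; apply.
  by apply/eqP => /(congr1 lsubmx); rewrite row_mxKl => /rowP/(_ 0);
    rewrite !mxE.
have a0 : 0 < a by exact: lt_le_trans ca.
have AE : A = D *m D^T by rewrite {1}DA -mulmxA BD mulmx1.
have [[BD11 BD12] [BD21 BD22]] : (B1 *m D1^T = 1%:M /\ B1 *m D2^T = 0) /\
    (B2 *m D1^T = 0 /\ B2 *m D2^T = 1%:M).
  move: BD; rewrite /B /D tr_col_mx mul_col_row scalar_mx_block.
  by move/eq_block_mx => [-> -> -> ->].
pose A12 := D1 *m D2^T; pose A21 := D2 *m D1^T; pose A22 := D2 *m D2^T.
have A11 : D1 *m D1^T = a%:M by rewrite [LHS]mx11_scalar -dot_mxE.
have [D1E D2E] : D1 = a *: B1 + A12 *m B2 /\ D2 = A21 *m B1 + A22 *m B2.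
  move: DA; rewrite AE /D /B tr_col_mx mul_col_row mul_block_col A11.
  by rewrite mul_scalar_mx => /eq_col_mx.
(* The component of [B1] along [D1] has squared length [1 / a], so only the part of [B1] in the span
   of [B2] has to be reduced. *)
have B1E : B1 = a^-1 *: D1 - (a^-1 *: A12) *m B2.
  by rewrite {1}D1E scalerDr scalerA mulVf ?gt_eqF// scale1r -scalemxAl addrK.
(* The projection of [D2] orthogonal to [D1] is the dual basis of [B2]. *)
pose D' := D2 - (a^-1 *: A21) *m D1.
have D'E : D' = (A22 - (a^-1 *: A21) *m A12) *m B2.
  rewrite /D' {1}D2E D1E mulmxDr mulmxBl -!scalemxAl -scalemxAr scalerA.
  rewrite mulVf ?gt_eqF// scale1r (mulmxA A21 A12) opprD.
  by rewrite addrACA subrr add0r.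
have BD' : B2 *m D'^T = 1%:M.
  by rewrite /D' linearB /= trmx_mul mulmxBr BD22 mulmxA BD21 mul0mx subr0.
have cD' (y : 'rV[int]_k) : y != 0 -> c / 2 <= dot (toR y *m D') (toR y *m D').
  move=> y0.
  pose w := toR y *m D2.
  pose t := dot w D1 / a.
  have -> : toR y *m D' = w - t *: D1.
    rewrite /D' mulmxBr mulmxA -scalemxAr /A21 mulmxA -scalemxAl.
    congr (_ - _); rewrite /t mulrC -scalerA; congr (_ *: _).
    by rewrite [X in X *m D1]mx11_scalar mul_scalar_mx -dot_mxE.
  (* [n] is a nearest integer to [t]. The dual vector [w - n D1] is nonzero and has squared length
     [|w - t D1|^2 + (t - n)^2 a], so [|w - t D1|^2 >= a - c/10 - a/4 >= c/2]. *)
  pose n := Num.floor (t + 1/2).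
  have [n1 n2] : n%:~R <= t + 1/2 /\ t + 1/2 < n%:~R + 1.
    have /andP[h1 h2] := floor_itv (t + 1/2).
    by split => //; rewrite intrD in h2.
  have := aD (row_mx (- n)%:M y).
  have -> : toR (row_mx (- n)%:M y) *m D = w - n%:~R *: D1.
    by rewrite map_row_mx mul_row_col map_scalar_mx mul_scalar_mx addrC rmorphN
      scaleNr.
  have -> : row_mx (- n)%:M y != 0.
    apply: contra_neq y0 => /(congr1 rsubmx); rewrite row_mxKr => ->.
    by apply/rowP => i; rewrite !mxE.
  move/(_ isT).
  rewrite !dotE (dotC D1 w) -/a.
  have -> : dot w D1 = t * a by rewrite /t divfK// gt_eqF.
  have h : (t - n%:~R) ^+ 2 <= 1 / 4 by rewrite expr2; nra.
  have : (t - n%:~R) ^+ 2 * a <= 1 / 4 * a by rewrite ler_pM2r.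
  move: ca; rewrite expr2; move: (dot w w) => W; lra.
have [U' uU' U'C] := IH D' B2 _ BD' D'E cD'.
(* [B1 + r (U' B2) = a^-1 D1]; replacing [r] by its integral part [s] leaves an error with
   coefficients of absolute value at most 1. *)
pose r := a^-1 *: A12 *m invmx (toR U').
pose s : 'rV[int]_k := map_mx Num.floor r.
pose U : 'M[int]_(1 + k) := block_mx 1%:M (s *m U') 0 U'.
exists U.
  by rewrite unitmxE det_ublock det1 mul1r -unitmxE.
have UB : toR U *m B = col_mx (a^-1 *:
  D1 + (toR s - r) *m (toR U' *m B2)) (toR U' *m B2).
  rewrite map_block_mx /B mul_block_col map_mx0 map_mx1 mul0mx add0r mul1mx.
  congr col_mx; rewrite map_mxM mulmxBl {1}B1E !mulmxA.
  by rewrite mulmxKV ?unit_toR// addrAC addrA.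
move=> i; rewrite UB le_max; case: (split_ordP i) => j ->.
  apply/orP; right; rewrite rowKu row_id ?ord1//.
  apply: le_trans (dot_add_le _ _) _; rewrite ler_pM2l//; apply: lerD.
    rewrite !dotE -/a mulrA; rewrite mulfVK ?gt_eqF//.
    by rewrite div1r lef_pV2 ?posrE.
  apply: dot_mulmx_le => // l.
  have -> : (toR s - r) 0 l = (Num.floor (r 0 l))%:~R - r 0 l by rewrite !mxE.
  have /andP[h1 h2] := floor_itv (r 0 l); rewrite intrD in h2.
  rewrite ler_norml; apply/andP; split; lra.
by rewrite rowKd U'C.
Qed.

(** Induction on the rank: an almost shortest dual vector becomes the first vector of the dual
    basis, and the remaining vectors are treated by the previous rank with [c / 2] for [c]. *)
Lemma short_basisP k : short_basis k.
Proof.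
elim: k => [|k IH] c c0.
  by exists 0 => M D B A _ _ _; exists 1%:M; [exact: unitmx1|case].
have [C HC] := IH (c / 2) (divr_gt0 c0 (ltr0n _ 2)).
exists (Num.max C (2 * (1 / c + k%:R * (k%:R * C)))).
move=> M; rewrite -[k.+1]/(1 + k)%N => D B A BD DA cD.
pose E := [set dot (toR y *m D) (toR y *m D) | y in [set y :
  'rV[int]_(1 + k) | y != 0]].
have lbE : has_lbound E by exists c => _ [y y0 <-]; exact: cD.
have hE : has_inf E.
  split => //; exists (dot (toR (const_mx 1) *m D) (toR (const_mx 1) *m D)).
  by exists (const_mx 1) => //=; apply/eqP => /rowP/(_ 0); rewrite !mxE.
(* A vector within [c / 10] of the infimum is enough for [short_basis_step], so no minimum has to be
   attained. *)
have [|_ [y0 y00 <-] y0E] := @inf_adherent _ E (c / 10) _ hE; first by lra.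
have [V uV [s s0 y0V]] := int_row_primitive y00.
have uVR := unit_toR uV.
(* [y0] is a nonzero integral multiple of the primitive vector [row 0 V], which is therefore no
   longer than [y0]. *)
have {}y0E (y : 'rV[int]_(1 + k)) : y != 0 ->
    dot (row 0 (toR V) *m D) (row 0 (toR V) *m D) - c / 10 <=
    dot (toR y *m D) (toR y *m D).
  move=> yn0; rewrite lerBlDr.
  apply: le_trans (_ : inf E + c / 10 <= _); last first.
    by rewrite lerD2r; apply: ge_inf => //; exists y.
  apply: ltW; apply: le_lt_trans y0E; rewrite y0V map_mxZ /= -scalemxAl !dotE.
  rewrite mulrA -map_row ler_peMl ?dot_ge0// -intrM -[1]/(1%:~R) ler_int.
  move: s0; lia.
(* [V] changes the dual basis and its inverse transpose the basis, so the two stay dual. *)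
pose D' := toR V *m D; pose B' := (invmx (toR V))^T *m B.
have BD' : B' *m D'^T = 1%:M.
  rewrite /B' /D' trmx_mul mulmxA -(mulmxA _ B) BD mulmx1 -trmx_mul.
  by rewrite mulmxV// trmx1.
have VE (y : 'rV[int]_(1 + k)) : toR y *m D' = toR (y *m V) *m D.
  by rewrite map_mxM mulmxA.
have V0 (y : 'rV[int]_(1 + k)) : y != 0 -> y *m V != 0.
  by apply: contra_neq => /(congr1 (mulmx^~ (invmx V)));
    rewrite mulmxK// mul0mx.
have [||||U uU UC] := @short_basis_step k c C M (usubmx D') (usubmx B')
   (dsubmx D') (dsubmx B') (toR V *m A *m (toR V)^T) c0 (HC M);
     rewrite ?vsubmxK//.
- rewrite /D' /B' DA -!mulmxA; congr (_ *m (_ *m _)).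
  by rewrite mulmxA -trmx_mul mulVmx// trmx1 mul1mx.
- by move=> y yn0; rewrite VE cD// V0.
- move=> y yn0; rewrite VE; apply: le_trans (y0E _ (V0 _ yn0)).
  have -> // : usubmx D' = row 0 (toR V) *m D.
  rewrite -row_mul -/D'; apply/rowP => j; rewrite [LHS]mxE [RHS]mxE;
    congr (D' _ _); exact/val_inj.
rewrite vsubmxK in UC.
exists (U *m (invmx V)^T).
  by rewrite unitmx_mul uU unitmx_tr unitmx_inv.
move=> i; rewrite map_mxM -mulmxA.
have -> // : toR (invmx V)^T *m B = B'.
congr (_ *m B); rewrite -map_trmx; congr (_^T).
rewrite -[RHS]mul1mx; apply: (canRL (mulmxK uVR)).
by rewrite -map_mxM mulVmx// map_mx1.
Qed.


End LatticeReduction.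

(** * Invariant packings and coverings *)

Section Isometries.
Context {R : realType} {X : metricType R}.
Implicit Types (f g h : X -> X) (A K : set X).

Lemma interior_mdist A x :
  interior A x <-> exists2 e : R, 0 < e & forall y, mdist x y < e -> A y.
Proof.
split.
  rewrite /interior /= => /nbhs_ballP[e /= e0 eA]; exists e => // y xy.
  by apply: eA; rewrite ballEmdist.
move=> [e e0 eA]; apply/nbhs_ballP; exists e => //= y.
by rewrite ballEmdist; exact: eA.
Qed.

Lemma isometry_comp f g :
  metric_isometry f -> metric_isometry g -> metric_isometry (f \o g).
Proof.
move=> [bf df] [bg dg]; split; first exact: bij_comp.
by move=> x y /=; rewrite df dg.
Qed.

Lemma isometry_interior f A :
  metric_isometry f -> interior (f @` A) = f @` interior A.
Proof.
move=> [[f' fK f'K] df]; apply/seteqP; split => x.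
  move=> /interior_mdist[e e0 eA]; exists (f' x); last by rewrite f'K.
  apply/interior_mdist; exists e => // y; rewrite -df f'K => /eA[z Az].
  by move/(can_inj fK) => <-.
move=> [y /interior_mdist[e e0 eA] <-]; apply/interior_mdist.
exists e => // z yz; exists (f' z); last by rewrite f'K.
by apply: eA; rewrite -df f'K.
Qed.

Lemma replica_isometry K f A :
  metric_isometry f -> replica K A -> replica K (f @` A).
Proof.
move=> If [g Ig ->]; exists (f \o g); first exact: isometry_comp.
by rewrite image_comp.
Qed.

Lemma replica_diam K A (delta : R) :
  (forall x y, K x -> K y -> mdist x y <= delta) -> replica K A ->
  forall x y, A x -> A y -> mdist x y <= delta.
Proof.
by move=> dK [f [_ df] ->] _ _ [x Kx <-] [y Ky <-]; rewrite df; exact: dK.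
Qed.

Lemma compact_diam K : compact K ->
  exists delta : R, forall x y, K x -> K y -> mdist x y <= delta.
Proof.
move=> cK; have [[x0 Kx0]|K0] := pselect (K !=set0); last first.
  by exists 0 => x y Kx; exfalso; apply: K0; exists x.
have /compact_near_coveringP nc := cK.
(* Compactness, as a near-covering property along the filter at infinity, gives one radius of a ball
   about [x0] that contains all of [K]. *)
have [] := nc R (pinfty_nbhs R) (fun M x => mdist x0 x < M) _.
  move=> x Kx; near_simpl.
  exists (ball x 1, [set M | mdist x0 x + 1 < M]).
    split => /=; first exact: nbhsx_ballx.
    by apply: nbhs_pinfty_gt; rewrite num_real.
  move=> [y M] [/=]; rewrite ballEmdist /= => xy; apply: lt_trans.
  by apply: (le_lt_trans (metric_triangle x0 x y)); rewrite ltrD2l.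
move=> M [_ MK]; exists (2 * (M + 1)) => x y Kx Ky.
have MM : M < M + 1 by rewrite ltrDl.
have h1 := MK _ MM _ Kx; have h2 := MK _ MM _ Ky.
by have := metric_triangle x x0 y; rewrite (metric_sym x x0);
  move: h1 h2 => /=; lra.
Qed.

End Isometries.

(** The total weight is the sum over the components, so some component has positive weight. The
    weights will be 1 and -1, according to whether a member is added or removed. *)
Lemma heavy_component (T : finType) (e : rel T) (w : T -> int) :
  connect_sym e -> 0 < \sum_x w x ->
  exists x, 0 < \sum_(y | connect e x y) w y.
Proof.
move=> se; rewrite (partition_big (fingraph.root e) predT)//= => h.
apply/not_existsP => h'; move: h; rewrite ltNge sumr_le0// => r _.
have [/existsP[x /eqP xr]|] := boolP [exists x, fingraph.root e x == r].
  rewrite leNgt; apply/negP; rewrite -xr => h.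
  apply: (h' x); congr (0 < _): h; apply: eq_bigl => y.
  by rewrite eq_sym root_connect.
rewrite negb_exists => /forallP h; rewrite big_pred0// => x.
exact: negbTE (h x).
Qed.

(** * Connected components of an intersection graph *)

Section Clusters.
Context {R : realType} {X : metricType R} {V : finType} (S : V -> set X).

Definition touch : rel V := fun u v => `[< S u `&` S v !=set0 >].

Lemma touch_sym : connect_sym touch.
Proof. by apply: sym_connect_sym => u v; rewrite /touch setIC. Qed.

(** A path without repeated vertices passes through at most [#|V|] sets, and each of them
    contributes at most [delta]. *)
Lemma cluster_diam (delta : R) u v x y :
  (forall w x y, S w x -> S w y -> mdist x y <= delta) ->
  connect touch u v -> S u x -> S v y -> mdist x y <= #|V|%:R * delta.
Proof.
move=> dS /connectP[p0 p0P ->] Sx.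
have d0 : 0 <= delta by have := dS _ _ _ Sx Sx; rewrite mdistxx.
have walk p u' x' : path touch u' p -> S u' x' -> S (last u' p) y ->
    mdist x' y <= (size p).+1%:R * delta.
  elim: p u' x' => [|v' p IH] u' x' /=.
    by rewrite mul1r => _; exact: dS.
  move=> /andP[/asboolP[z [Sz Sz']] pp] Sx' Sy.
  rewrite -natr1 mulrDl mul1r addrC.
  apply: le_trans (metric_triangle _ z _) _; apply: lerD; first exact: dS Sz.
  exact: IH Sy.
have [p pP up _] := shortenP p0P.
move=> /(walk _ _ _ pP Sx) h; apply: le_trans h _; rewrite ler_wpM2r// ler_nat.
by have := max_card (mem (u :: p)); rewrite (card_uniqP up).
Qed.

End Clusters.

Lemma card_exchange (T B : finType) (J : {set T}) (P : pred B) :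
  #|{: {t : T | t \notin J} + {b : B | P b}}| =
  (#|T| - #|J| + #|[pred b | P b]|)%N.
Proof.
rewrite card_sum !card_sig -(cardsC J) addKn; congr (_ + _)%N.
by apply: eq_card => t; rewrite !inE.
Qed.

Lemma finite_enum (I : Type) (D : set I) m : (D #= `I_m)%card ->
  exists2 e : 'I_m -> I, injective e & forall i, D i <-> exists a, i = e a.
Proof.
move=> /card_set_bijP[f [fD finj fsur]].
have /choice[e eP] : forall a : 'I_m, exists i, D i /\ f i = a.
  by move=> a; have [i Di fi] := fsur a (ltn_ord a); exists i.
exists e => [a b ab|i].
  by apply: val_inj; rewrite /= -(eP a).2 -(eP b).2 ab.
split => [Di|[a ->]]; last by case: (eP a).
have lt : (f i < m)%N by exact: fD.
exists (Ordinal lt); apply: finj; rewrite ?inE//;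
  first by case: (eP (Ordinal lt)).
by rewrite (eP (Ordinal lt)).2.
Qed.

(** * Orbit families under a group of isometries *)

Section DeckGroup.
Context {R : realType} {X : metricType R}.

Record isometry_group (Gam : set (X -> X)) : Prop := IsometryGroup {
  ig_isom : forall g, Gam g -> metric_isometry g;
  ig_id : Gam id;
  ig_comp : forall g h, Gam g -> Gam h -> Gam (g \o h);
  ig_inv : forall g, Gam g -> exists2 h, Gam h & cancel g h /\ cancel h g }.

Definition displaces (Gam : set (X -> X)) (D : R) : Prop :=
  forall g x, Gam g -> mdist x (g x) <= D -> g = id.

Definition cocompact (Gam : set (X -> X)) : Prop :=
  exists (x0 : X) (r : R), forall x, exists2 g, Gam g & mdist x0 (g x) <= r.

(** Total boundedness of balls, expressed by the size of separated finite families. *)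
Definition separated_bounded : Prop := forall (x0 : X) (r eps : R), 0 < eps ->
  exists N : nat, forall (T : finType) (f : T -> X),
    (forall t, mdist x0 (f t) <= r) ->
    (forall t t', t != t' -> eps <= mdist (f t) (f t')) -> (#|T| <= N)%N.

Variables (K : set X) (Gam : set (X -> X)).

(** [T] indexes representatives, so [#|T|] counts orbits. The group element is part of the index,
    which makes every translate a member of its own. *)
Definition orbit_family (T : Type) (F : T -> set X) (k : {g | Gam g} * T) :=
  sval k.1 @` F k.2.

Hypothesis GG : isometry_group Gam.

Variables (delta : R) (n : nat).
Hypothesis dK : forall x y, K x -> K y -> mdist x y <= delta.
(** An exchange involves [n - 1] members on one side and [n] on the other; the constant bounds the
    diameter of a component of their intersection graph. *)
Hypothesis dG : displaces Gam ((n.-1 + n)%:R * delta).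
Hypothesis n0 : (0 < n)%N.
Hypothesis K0 : K !=set0.

Lemma displaces_eq g h x y : Gam g -> Gam h -> g x = h y ->
  mdist x y <= (n.-1 + n)%:R * delta -> g = h.
Proof.
move=> Gg Gh gh xy; have [h' Gh' [hK h'K]] := ig_inv GG Gh.
have : h' \o g = id.
  by apply: (dG (x := x)); [exact: ig_comp|rewrite /= gh hK].
move=> /(congr1 (fun k => h \o k)) /= E; apply/funext => z.
by have := congr1 (fun k => k z) E; rewrite /= h'K.
Qed.

Lemma sig_eq (g h : {g | Gam g}) : sval g = sval h -> g = h.
Proof. exact: eq_sig_hprop (fun _ => @Prop_irrelevance _) g h. Qed.

Definition orbit_packing (k : nat) := exists (T : finType) (F : T -> set X),
  #|T| = k /\ packing_with K (orbit_family F).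

Definition orbit_covering (k : nat) := exists (T : finType) (F : T -> set X),
  #|T| = k /\ covering_with K (orbit_family F).

Lemma orbit_replica T (F : T -> set X) :
  (forall t, replica K (F t)) -> forall k, replica K (orbit_family F k).
Proof.
move=> rF [[g Gg] t] /=; apply: replica_isometry => //=; exact: ig_isom Gg.
Qed.

Lemma orbit_replica_base T (F : T -> set X) :
  (forall k, replica K (orbit_family F k)) -> forall t, replica K (F t).
Proof.
move=> rF t; have := rF (exist _ id (ig_id GG), t).
by rewrite /orbit_family /= image_id.
Qed.

Lemma maximal_packing_saturated (T : finType) (F : T -> set X) :
  packing_with K (orbit_family F) ->
  (forall k, orbit_packing k -> (k <= #|T|)%N) ->
  n_saturated n K (orbit_family F).
Proof.
move=> [rF tF] maxT [D [G [/finite_enum[e einj eD] [rE tE]]]].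
pose P := orbit_family F.
have rG b : replica K (G b) by have := rE (inr b).
(* The graph is built on interiors, since only these must be disjoint in a packing. *)
pose S (v : 'I_(n - 1) + 'I_n) : set X :=
  match v with inl a => interior (P (e a)) | inr b => interior (G b) end.
have dS v x y : S v x -> S v y -> mdist x y <= delta.
  case: v => [a|b] /= /interior_subset Sx /interior_subset Sy.
    exact: (replica_diam dK (rF (e a))).
  exact: (replica_diam dK (rG b)).
pose w (v : 'I_(n - 1) + 'I_n) : int := if v is inl _ then -1 else 1.
have [|r] := heavy_component (w := w) (touch_sym S).
  rewrite big_sumType /= !sumr_const !card_ord; lia.
rewrite big_sumType /= !sumr_const.
pose C := connect (touch S) r; rewrite -/C.
set aC := (X in (-1) *+ X); set bC := (X in 1 *+ X) => abC.
have Cd u v x y : C u -> C v -> S u x -> S v y ->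
    mdist x y <= (n.-1 + n)%:R * delta.
  move=> Cu Cv; have uv : connect (touch S) u v.
    by apply: connect_trans Cv; rewrite (touch_sym S).
  have := @cluster_diam _ _ _ _ _ _ _ x y dS uv.
  by rewrite card_sum !card_ord subn1.
(* The orbits of the removed members of the component. Several of these members may share an orbit,
   but [#|J| <= aC] suffices to increase the number of orbits. *)
pose J := [set (e a).2 | a in [pred a | C (inl a)]]%SET.
pose T' := ({t : T | t \notin J} + {b : 'I_n | C (inr b)})%type.
pose F' (t : T') := match t with inl t => F (val t) | inr b => G (val b) end.
suff : orbit_packing #|{: T'}|.
  move/maxT; rewrite leqNgt => /negP; apply.
  have JC : (#|J| <= aC)%N by exact: leq_imset_card.
  have JT : (#|J| <= #|T|)%N by exact: max_card.
  rewrite card_exchange; move: JC JT abC; rewrite mulNrn !natz.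
  have -> : #|[pred b | C (inr b)]| = bC by apply: eq_card => b; rewrite !inE.
  clearbody aC bC; move: #|J| #|_| => x y; lia.
exists T', F'; split => //.
have rF' : forall t, replica K (F' t).
  by move=> [t|b] /=; [exact: (orbit_replica_base rF)|exact: rG].
split; first exact: orbit_replica.
have Gi := ig_isom GG.
(* Pulled back by [g'], an old member meeting [G b] is either kept, against the exchanged packing,
   or removed; in the latter case it lies in the component of [G b] and its orbit is in [J]. *)
have cross g t g' (b : 'I_n) : t \notin J -> C (inr b) -> Gam g -> Gam g' ->
    ~ (interior (g @` F t) `&` interior (g' @` G b) !=set0).
  move=> tJ Cb Gg Gg' [z]; rewrite !isometry_interior; [|exact: Gi..].
  move=> [[x Fx xz] [y Gy yz]].
  have [h Gh [g'K hK]] := ig_inv GG Gg'.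
  pose i : {g | Gam g} * T := (exist _ (h \o g) (ig_comp GG Gh Gg), t).
  have Piy : interior (P i) y.
    rewrite /P /orbit_family /= isometry_interior;
      last exact: isometry_comp (Gi _ Gh) (Gi _ Gg).
    by exists x => //=; rewrite xz -yz g'K.
  have [/eD[a ia]|Di] := pselect (D i).
    move/negP: tJ; apply; apply/imsetP; exists a; last by rewrite -ia.
    rewrite inE; apply: connect_trans Cb _; apply: connect1; apply/asboolP.
    by exists y; split => //=; rewrite -ia.
  have ne : interior (P i) `&` interior (G b) !=set0 by exists y.
  by have := tE (inl (exist _ i Di)) (inr b) I I ne.
move=> [[g Gg] [[t tJ]|[b Cb]]] [[g' Gg'] [[t' tJ']|[b' Cb']]] _ _ /= h.
- have := tF (exist _ g Gg, t) (exist _ g' Gg', t') I I h.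
  by case => gg tt; congr (_, inl _); [exact: sig_eq|exact: val_inj].
- by case: (cross _ _ _ _ tJ Cb' Gg Gg').
- by rewrite setIC in h; case: (cross _ _ _ _ tJ' Cb Gg' Gg).
- case: h => z; rewrite /orbit_family /= !isometry_interior; [|exact: Gi..].
  move=> [[x Gx xz] [y Gy yz]].
  (* [x] and [y] lie in members of one component, so the displacement bound identifies the two group
     elements; the exchanged packing then identifies [b] and [b']. *)
  have gg : g = g'.
    by apply: (displaces_eq Gg Gg' (x := x) (y := y));
      [rewrite xz|exact: (Cd _ _ _ _ Cb Cb')].
  have xy : x = y.
    by have [[h' hK _] _] := Gi _ Gg; apply: (can_inj hK); rewrite xz -yz gg.
  have bb : b = b'.
    have ne : interior (G b) `&` interior (G b') !=set0.
      by exists x; split => //; rewrite xy.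
    by have [] := tE (inr b) (inr b') I I ne.
  by congr (_, inr _); [exact: sig_eq|exact: val_inj].
Qed.

Lemma minimal_covering_reduced (T : finType) (F : T -> set X) :
  covering_with K (orbit_family F) ->
  (forall k, orbit_covering k -> (#|T| <= k)%N) ->
  n_reduced n K (orbit_family F).
Proof.
move=> [rF cF] minT [D [G [/finite_enum[e einj eD] [rE cE]]]].
pose P := orbit_family F.
have rG b : replica K (G b) by have := rE (inr b).
pose S (v : 'I_n + 'I_(n - 1)) : set X :=
  match v with inl a => P (e a) | inr b => G b end.
have dS v x y : S v x -> S v y -> mdist x y <= delta.
  case: v => [a|b] /= Sx Sy; first exact: (replica_diam dK (rF (e a))).
  exact: (replica_diam dK (rG b)).
pose w (v : 'I_n + 'I_(n - 1)) : int := if v is inl _ then 1 else -1.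
have [|r] := heavy_component (w := w) (touch_sym S).
  rewrite big_sumType /= !sumr_const !card_ord; lia.
rewrite big_sumType /= !sumr_const.
pose C := connect (touch S) r; rewrite -/C.
set aC := (X in 1 *+ X); set bC := (X in (-1) *+ X) => abC.
have Cd u v x y : C u -> C v -> S u x -> S v y ->
    mdist x y <= (n.-1 + n)%:R * delta.
  move=> Cu Cv; have uv : connect (touch S) u v.
    by apply: connect_trans Cv; rewrite (touch_sym S).
  have := @cluster_diam _ _ _ _ _ _ _ x y dS uv.
  by rewrite card_sum !card_ord subn1 addnC.
pose J := [set (e a).2 | a in [pred a | C (inl a)]]%SET.
pose T' := ({t : T | t \notin J} + {b : 'I_(n - 1) | C (inr b)})%type.
pose F' (t : T') := match t with inl t => F (val t) | inr b => G (val b) end.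
have mv := ig_isom GG.
(* [sval (e a').1] after the inverse of [g] moves [x] to a point of [P (e a')], that is, within the
   component; by the displacement bound it is the identity. *)
have translate a a' g x : C (inl a) -> C (inl a') -> Gam g ->
    P (e a) x -> (g @` F (e a').2) x -> g = sval (e a').1.
  move=> Ca Ca' Gg Px [y Fy yx]; pose g' := sval (e a').1.
  have [h Gh [gK hK]] := ig_inv GG Gg.
  have E : g' \o h = id.
    apply: (dG (x := x)); first by apply: ig_comp => //; exact: svalP (e a').1.
    apply: (Cd _ _ _ _ Ca Ca') => //=; rewrite -yx gK.
    by exists y.
  by apply/funext => u; rewrite -[LHS](congr1 (fun k => k (g u)) E) /= gK.
have JT : (#|J| <= #|T|)%N by exact: max_card.
(* For the number of orbits to drop, the removed members of the component must lie in distinct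
   orbits; [translate] gives this. *)
have JC : #|J| = aC.
  rewrite /J card_in_imset.
    by apply: eq_card => a; rewrite !inE.
  move=> a a'; rewrite !inE => Ca Ca' aa'; apply: einj.
  have [x Px] : P (e a) !=set0.
    rewrite /P; have [f _ ->] := rF (e a); have [x Kx] := K0; by exists (f x);
      exists x.
  have := translate a a' (sval (e a).1) x Ca Ca' (svalP (e a).1) Px.
  rewrite -aa' => /(_ Px) /sig_eq; move: aa'.
  by case: (e a) (e a') => [g t] [g' t'] /= -> ->.
suff : orbit_covering #|{: T'}|.
  move/minT; rewrite leqNgt => /negP; apply.
  rewrite card_exchange; move: JC JT abC; rewrite mulNrn !natz.
  have -> : #|[pred b | C (inr b)]| = bC by apply: eq_card => b; rewrite !inE.
  clearbody aC bC; move: #|J| #|_| => x y; lia.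
exists T', F'; split => //.
have rF' : forall t, replica K (F' t).
  by move=> [t|b] /=; [exact: (orbit_replica_base rF)|exact: rG].
split; first exact: orbit_replica.
apply/seteqP; split => // z _.
have [[[g Gg] t] _ Ftz] : (\bigcup_k orbit_family F k) z by rewrite cF.
have [/imsetP[a]|tJ] := boolP (t \in J); last first.
  by exists (exist _ g Gg, inl (exist _ t tJ)).
rewrite inE => Ca ta; rewrite {}ta {t} in Ftz.
case: Ftz => x /= Fx xz.
(* The point [z] is carried into the removed member [P (e a)]. There the exchanged covering offers
   either a new member, which then touches the component, or a kept one, whose orbit is outside [J]
   by [translate]; either is carried back to [z]. *)
pose g0 := sval (e a).1; have Gg0 : Gam g0 := svalP (e a).1.
have [h0 Gh0 [g0K h0K]] := ig_inv GG Gg0.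
have Py : P (e a) (g0 x) by exists x.
have Gk : Gam (g \o h0) by exact: ig_comp.
have kz : (g \o h0) (g0 x) = z by rewrite /= g0K.
have : [set: X] (g0 x) by [].
rewrite -cE => -[[[i Di]|b] _ /= yi].
- have [/imsetP[a']|tJ] := boolP (i.2 \in J); last first.
    exists (exist _ ((g \o h0) \o sval i.1) (ig_comp GG Gk (svalP i.1)), inl
      (exist _ i.2 tJ)) => //=.
    by case: yi => u Fu uy; exists u => //=; rewrite uy.
  rewrite inE => Ca' ia'; exfalso; apply: Di; apply/eD; exists a'.
  have := translate a a' (sval i.1) _ Ca Ca' (svalP i.1) Py.
  rewrite -ia' => /(_ yi) /sig_eq; move: ia'.
  by case: (i) (e a') => [? ?] [? ?] /= -> ->.
- have Cb : C (inr b).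
    apply: connect_trans Ca _; apply: connect1; apply/asboolP.
    by exists (g0 x).
  by exists (exist _ (g \o h0) Gk, inr (exist _ b Cb)) => //; exists (g0 x).
Qed.

(** Each representative is moved so that its copy of [c0] lies in a fixed ball. These centres are
    [rho] apart, since a closer pair would put one centre into both interiors. *)
Lemma orbit_packing_bounded :
  separated_bounded -> cocompact Gam -> interior K !=set0 ->
  exists N, forall k, orbit_packing k -> (k <= N)%N.
Proof.
move=> sb [x0 [r cc]] [c0 Kc0].
have /interior_mdist[rho rho0 Krho] : interior (interior K) c0.
  by rewrite (interior_id _).1//; exact: open_interior.
have [N sepN] := sb x0 r rho rho0.
exists N => _ [T [F [<- [rF tF]]]].
have /choice[f fP] : forall t, exists f, metric_isometry f /\ F t = f @` K.
  by move=> t; have [f If Ft] := orbit_replica_base rF t; exists f.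
have /choice[g gP] : forall t, exists g, Gam g /\ mdist x0 (g (f t c0)) <= r.
  by move=> t; have [g Gg gr] := cc (f t c0); exists g.
pose z t := g t (f t c0).
apply: (sepN T z) => [t|t t' tt']; first exact: (gP t).2.
rewrite leNgt; apply/negP => zz; move/eqP: tt'; apply.
have Ig u : metric_isometry (g u \o f u).
  by apply: isometry_comp; [exact: ig_isom GG _ (gP u).1|exact: (fP u).1].
pose P u : set X := orbit_family F (exist _ (g u) (gP u).1, u).
have PE u : interior (P u) = (g u \o f u) @` interior K.
  by rewrite -isometry_interior// -image_comp -(fP u).2.
have ne : interior (P t) `&` interior (P t') !=set0.
  exists (z t'); rewrite !PE; split; last by exists c0.
  have [[k hk kh] dk] := Ig t; exists (k (z t')); last exact: kh.
  by apply: Krho; rewrite -dk kh.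
by have [] := tF _ _ I I ne.
Qed.

(** A maximal [rho]-separated set in a ball meeting every orbit is also [rho]-dense there; copies of
    [K] placed at its points cover the ball, and their translates the space. *)
Lemma orbit_covering_exists :
  separated_bounded -> cocompact Gam -> interior K !=set0 ->
  (forall x y : X, exists2 f, metric_isometry f & f x = y) ->
  exists k, orbit_covering k.
Proof.
move=> sb [x0 [r cc]] [c0 /interior_mdist[rho rho0 Krho]] tr.
have [N sepN] := sb x0 r rho rho0.
pose sep k := `[< exists f : 'I_k -> X, (forall t, mdist x0 (f t) <= r) /\
  (forall t t', t != t' -> rho <= mdist (f t) (f t')) >].
have sep0 : exists k, sep k.
  by exists 0%N; apply/asboolP; exists (fun=> x0); split => -[].
have sepb k : sep k -> (k <= N)%N.
  by move=> /asboolP[f [f1 f2]]; rewrite -[k]card_ord; exact: sepN f1 f2.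
case: (ex_maxnP sep0 sepb) => k /asboolP[f [f1 f2]] kmax.
have near x : mdist x0 x <= r -> exists t, mdist (f t) x < rho.
  move=> xr; apply/not_existsP => far.
  suff /kmax : sep k.+1 by rewrite ltnn.
  (* A point far from all [f u] would extend the separated family; it takes the index [ord0]. *)
  apply/asboolP; exists (fun t => if unlift ord0 t is Some u then f u else x).
  split => [t|t t']; first by case: unliftP.
  have far' u : rho <= mdist (f u) x by rewrite leNgt; apply/negP/far.
  case: (unliftP ord0 t) => [u ->|->]; case: (unliftP ord0 t') => [u' ->|->] //.
  - by rewrite (inj_eq lift_inj); exact: f2.
  - by rewrite metric_sym.
have /choice[h hP] : forall t, exists h, metric_isometry h /\ h c0 = f t.
  by move=> t; have [h Ih hc] := tr c0 (f t); exists h.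
exists #|'I_k|, 'I_k, (fun t => h t @` K); split => //; split.
  by apply: orbit_replica => t; exists (h t) => //; exact: (hP t).1.
apply/seteqP; split => // x _.
have [g Gg gx] := cc x; have [t ft] := near _ gx.
have [g' Gg' [gK g'K]] := ig_inv GG Gg.
exists (exist _ g' Gg', t) => //; exists (g x) => //=.
have [[[h' hK h'K] dh] hc] := hP t.
exists (h' (g x)); last exact: h'K.
by apply: Krho; rewrite -dh h'K hc.
Qed.


End DeckGroup.

Theorem saturated_packing_reduced_covering (R : realType) (X : metricType R)
    (K : set X) (n : nat) :
  (forall x y : X, exists2 f, metric_isometry f & f x = y) ->
  separated_bounded (X := X) ->
  (forall D : R, exists2 Gam : set (X -> X), isometry_group Gam &
    cocompact Gam /\ displaces Gam D) ->
  body K -> (0 < n)%N ->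
  (exists (I : Type) (F : I -> set X), packing_with K F /\ n_saturated n K F) /\
  (exists (I : Type) (F : I -> set X), covering_with K F /\ n_reduced n K F).
Proof.
move=> tr sb deck [K0 cK _ KK] n0.
have [delta dK] := compact_diam cK.
have Ki : interior K !=set0.
  by apply/set0P; apply: contraPneq K0 => Ki; rewrite -KK Ki closure0 => -[].
have [Gam GG [cc dG]] := deck ((n.-1 + n)%:R * delta).
split.
- have [N bN] := orbit_packing_bounded GG sb cc Ki.
  pose p k := `[< orbit_packing K Gam k >].
  have p0 : exists k, p k.
    (* The empty family is an invariant packing with no orbits. *)
    exists 0%N; apply/asboolP; exists void, (fun=> K).
    by split; [exact: card_void|split => [[_ []]|[_ []]]].
  have pN k : p k -> (k <= N)%N by move=> /asboolP /bN.
  case: (ex_maxnP p0 pN) => _ /asboolP[T [F [<- pF]]] maxT.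
  exists ({g | Gam g} * T)%type, (orbit_family F); split => //.
  apply: (maximal_packing_saturated GG dK dG n0 pF).
  by move=> k /asboolP /maxT.
- pose p k := `[< orbit_covering K Gam k >].
  have p0 : exists k, p k.
    by have [k kP] := orbit_covering_exists GG sb cc Ki tr; exists k;
      apply/asboolP.
  case: (ex_minnP p0) => _ /asboolP[T [F [<- cF]]] minT.
  exists ({g | Gam g} * T)%type, (orbit_family F); split => //.
  apply: (minimal_covering_reduced GG dK dG n0 K0 cF).
  by move=> k /asboolP /minT.
Qed.

(** * Euclidean space *)

(** Pigeonhole: the box is cut into cells of side [eta], and two points in one cell differ by less
    than [eta] in every coordinate. *)
Lemma grid_bounded (R : realType) d (rho eta : R) : 0 < eta ->
  exists N : nat, forall (T : finType) (f : T -> 'rV[R]_d),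
    (forall t i, `|f t 0 i| <= rho) ->
    (forall t t', t != t' -> exists i, eta <= `|f t 0 i - f t' 0 i|) ->
    (#|T| <= N)%N.
Proof.
move=> eta0; pose M := `|Num.floor (2 * rho / eta)|%N.
exists #|{ffun 'I_d -> 'I_M.+1}| => T f f1 f2.
pose z t i := Num.floor ((f t 0 i + rho) / eta).
have zM t i : 0 <= z t i <= M%:Z.
  have := f1 t i; rewrite ler_norml => /andP[h1 h2].
  have h0 : 0 <= rho by lra.
  rewrite /z floor_ge0 divr_ge0 ?(ltW eta0)//=; last lra.
  rewrite gez0_abs; last by rewrite floor_ge0 divr_ge0 ?(ltW eta0)//; lra.
  by apply: le_floor; rewrite ler_pM2r ?invr_gt0//; lra.
pose code t : {ffun 'I_d -> 'I_M.+1} := [ffun i => inord `|z t i|%N].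
apply: (@leq_card _ _ code) => t t' /ffunP tt'; apply/eqP/negPn/negP.
move=> /f2[i]; apply/negP; rewrite -ltNge.
have zz : z t i = z t' i.
  have := congr1 val (tt' i); rewrite !ffunE /=.
  have := zM t i; have := zM t' i; move: (z t i) (z t' i) => a b ha hb.
  rewrite !inordK; lia.
have /andP[h1 h2] := floor_itv ((f t 0 i + rho) / eta).
have /andP[h3 h4] := floor_itv ((f t' 0 i + rho) / eta).
rewrite -/(z t i) zz in h1 h2; rewrite -/(z t' i) in h3 h4.
rewrite intrD in h2 h4.
have : `|(f t 0 i + rho) / eta - (f t' 0 i + rho) / eta| < 1.
  by rewrite ltr_norml; apply/andP; split; lra.
rewrite -mulrBl normrM [`|eta^-1|]gtr0_norm ?invr_gt0// ltr_pdivrMr// mul1r.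
by rewrite opprD addrACA subrr addr0.
Qed.

Section EuclideanSpace.
Context {R : realType} {d : nat}.
Local Notation E := (euclidean R d).
Local Notation toR := (map_mx (intr : int -> R)).

Lemma dot_le_sup (u : 'rV[R]_d) (c : R) :
  (forall i, `|u 0 i| <= c) -> dot u u <= d%:R * c ^+ 2.
Proof.
move=> uc; rewrite -[d in leRHS]card_ord mulr_natl -sumr_const.
apply: ler_sum => i _.
by rewrite -expr2 -real_normK ?num_real// ler_pXn2r ?nnegrE// (le_trans _ (uc
  i)).
Qed.

Lemma coord_le_dot (u : 'rV[R]_d) i : (u 0 i) ^+ 2 <= dot u u.
Proof.
rewrite /dot (bigD1 i)//= -expr2 lerDl.
by apply: sumr_ge0 => j _; rewrite -expr2 sqr_ge0.
Qed.

Lemma coord_le_eudist (x y : E) i : `|(x : 'rV_d) 0 i - (y :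
  'rV_d) 0 i| <= eudist x y.
Proof.
rewrite -sqrtr_sqr ler_wsqrtr//.
by have := coord_le_dot ((x : 'rV_d) - y) i; rewrite !mxE.
Qed.

Lemma euclidean_transitive (x y : E) :
  exists2 f : E -> E, metric_isometry f & f x = y.
Proof.
exists (fun z : E => (z : 'rV[R]_d) + (y - x) : E);
  last by rewrite /= addrC subrK.
split; first by exists (fun z : E => (z : 'rV[R]_d) - (y - x) : E) => z;
  rewrite ?addrK ?subrK.
move=> u v; rewrite /mdist /= /eudist.
by congr (Num.sqrt (dot _ _)); rewrite opprD addrACA subrr addr0.
Qed.

Lemma euclidean_separated : separated_bounded (X := E : metricType R).
Proof.
move=> x0 r eps eps0.
(* The denominator [d + 1] allows dimension 0 and makes [sqrt d * eta < eps] strict. *)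
pose eta := eps / d.+1%:R.
have eta0 : 0 < eta by rewrite divr_gt0.
have [N NP] := grid_bounded d (r + \sum_i `|(x0 : 'rV_d) 0 i|) eta0.
exists N => T f f1 f2; apply: (NP T (f : T -> 'rV[R]_d)) => [t i|t t' tt'].
  have -> : (f t : 'rV_d) 0 i =
    ((f t : 'rV_d) 0 i - (x0 : 'rV_d) 0 i) + (x0 : 'rV_d) 0 i by rewrite subrK.
  apply: le_trans (ler_normD _ _) _; apply: lerD.
    rewrite distrC; apply: le_trans (f1 t); exact: coord_le_eudist.
  by rewrite (bigD1 i)//= lerDl sumr_ge0.
apply/not_existsP => far.
have : mdist (f t) (f t') < eps.
  apply: (@le_lt_trans _ _ (Num.sqrt (d%:R * eta ^+ 2))).
    apply: ler_wsqrtr; apply: dot_le_sup => i; rewrite !mxE ltW//.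
    by rewrite ltNge; apply/negP/far.
  rewrite -[ltRHS]gtr0_norm// -sqrtr_sqr ltr_sqrt ?exprn_gt0//.
  have -> : eps = d.+1%:R * eta by rewrite mulrC divfK.
  rewrite [ltRHS]exprMn ltr_pM2r ?exprn_gt0// -natrX ltr_nat; nia.
by rewrite ltNge f2.
Qed.

Lemma euclidean_deck (D : R) : exists2 Gam : set (E -> E),
  isometry_group (X := E : metricType R) Gam &
  cocompact (X := E : metricType R) Gam /\ displaces (X := E :
    metricType R) Gam D.
Proof.
(* A nonzero vector of [m Z^d] has a coordinate of absolute value at least [m], which exceeds
   [D]. *)
pose m := (`|Num.floor D|.+1)%:R : R.
have mD : D < m.
  apply: lt_le_trans (floorD1_gt D) _; rewrite /m pmulrn ler_int.
  move: (Num.floor D) => z; lia.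
have m0 : 0 < m by rewrite ltr0n.
pose tr (z : 'rV[int]_d) (x : E) : E := (x : 'rV[R]_d) + m *: toR z.
have trD z w x : tr z (tr w x) = tr (w + z) x.
  by rewrite /tr map_mxD scalerDr addrA.
have tr0 x : tr 0 x = x by rewrite /tr map_mx0 scaler0 addr0.
have trK z : cancel (tr z) (tr (- z)) by move=> x; rewrite trD subrr tr0.
have trNK z : cancel (tr (- z)) (tr z) by move=> x; rewrite trD addNr tr0.
exists (range tr).
  split.
  - move=> _ [z _ <-]; split; first by exists (tr (- z)).
    move=> u v; rewrite /mdist /= /eudist /tr.
    by congr (Num.sqrt (dot _ _)); rewrite opprD addrACA subrr addr0.
  - by exists 0 => //; apply/funext => x; rewrite tr0.
  - by move=> _ _ [z _ <-] [w _ <-]; exists (w + z) => //; apply/funext => x;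
    rewrite /= trD.
  - by move=> _ [z _ <-]; exists (tr (- z)); [exists (- z)|].
split.
  exists (0 : 'rV[R]_d), (Num.sqrt (d%:R * m ^+ 2)) => x.
  pose z : 'rV[int]_d := \row_i - Num.floor ((x : 'rV_d) 0 i / m).
  exists (tr z); first by exists z.
  apply: ler_wsqrtr; apply: dot_le_sup => i.
  rewrite !mxE rmorphN /=; set a := (x : 'rV_d) 0 i.
  have /andP[h1 h2] := floor_itv (a / m); rewrite intrD in h2.
  have aE : a = a / m * m by rewrite divfK// gt_eqF.
  rewrite {1}aE ler_norml; move: h1 h2; move: (a / m) (_%:~R) => u v h1 h2.
  by apply/andP; split; nra.
move=> _ x [z _ <-] h; suff -> : z = 0 by apply/funext => y; rewrite tr0.
apply/rowP => i; rewrite mxE; apply/eqP/negPn/negP => zi.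
have := coord_le_eudist x (tr z x) i; rewrite leNgt => /negP; apply.
apply: le_lt_trans h _; apply: lt_le_trans mD _.
rewrite /tr !mxE opprD addrA subrr add0r normrN normrM gtr0_norm// ler_peMr
  ?(ltW m0)//.
rewrite -intr_norm -[1]/(1%:~R) ler_int; lia.
Qed.

End EuclideanSpace.

(** * The hyperboloid model *)

Section HyperbolicGeometry.
Context {R : realType} {d : nat}.
Local Notation H := (hyperbolic R d).
Local Notation N := (1 + d)%N.

(** The Gram matrix of the Lorentz form. Points are row vectors, and matrices act on the right. *)
Definition hJ : 'M[R]_N := block_mx (-1)%:M 0 0 1%:M.

Definition lform (u v : 'rV[R]_N) : R := dot (u *m hJ) v.

Definition hvec (p : H) : 'rV[R]_N := row_mx (hpoint p).1%:M (hpoint p).2.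

Definition horigin : 'rV[R]_N := row_mx 1%:M 0.

Lemma dot_row_mx a b (u1 v1 : 'rV[R]_a) (u2 v2 : 'rV[R]_b) :
  dot (row_mx u1 u2) (row_mx v1 v2) = dot u1 v1 + dot u2 v2.
Proof.
rewrite /dot big_split_ord /=; congr (_ + _); apply: eq_bigr => i _.
  by rewrite !row_mxEl.
by rewrite !row_mxEr.
Qed.

Lemma dot_scalar (a b : R) : dot (a%:M : 'rV_1) b%:M = a * b.
Proof. by rewrite /dot big_ord1 !mxE !mulr1n. Qed.

Lemma hJ_sym : hJ^T = hJ.
Proof. by rewrite /hJ tr_block_mx !trmx0 !tr_scalar_mx. Qed.

Lemma hJK : hJ *m hJ = 1%:M.
Proof.
rewrite /hJ mulmx_block !mulmx0 !mul0mx !addr0 !add0r mulmx1 mul_scalar_mx.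
by rewrite scale_scalar_mx mulrNN mulr1 -scalar_mx_block.
Qed.

Lemma mul_row_hJ (a : R) (u : 'rV[R]_d) :
  row_mx a%:M u *m hJ = row_mx (- a)%:M u.
Proof.
rewrite /hJ mul_row_block !mulmx0 addr0 add0r mulmx1 mul_scalar_mx.
by rewrite scale_scalar_mx mulrN1.
Qed.

Lemma lformE (a b : R) (u v : 'rV[R]_d) :
  lform (row_mx a%:M u) (row_mx b%:M v) = dot u v - a * b.
Proof. by rewrite /lform mul_row_hJ dot_row_mx dot_scalar mulNr addrC. Qed.

Lemma row_splitE (u : 'rV[R]_N) : u = row_mx (u 0 0)%:M (rsubmx u).
Proof.
rewrite -{1}[u]hsubmxK; congr row_mx; rewrite [LHS]mx11_scalar; congr (_%:M).
by rewrite mxE; congr (u _ _); exact: val_inj.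
Qed.

Lemma lorentz_lform (p q : H) : lorentz (hpoint p) (hpoint q) =
  lform (hvec p) (hvec q).
Proof. by rewrite lformE. Qed.

Lemma lform_dot (u v : 'rV[R]_N) : lform u v = dot u (v *m hJ).
Proof.
by rewrite /lform !dot_mxE trmx_mul hJ_sym mulmxA.
Qed.

Lemma lformC (u v : 'rV[R]_N) : lform u v = lform v u.
Proof. by rewrite lform_dot dotC. Qed.

Lemma lformNl (u v : 'rV[R]_N) : lform (- u) v = - lform u v.
Proof. by rewrite /lform mulNmx dotNl. Qed.

Lemma lformNr (u v : 'rV[R]_N) : lform u (- v) = - lform u v.
Proof. exact: dotNr. Qed.

(** [hJ] is orthogonal for the Euclidean product, so this is Cauchy-Schwarz for [u *m hJ] and
    [v]. *)
Lemma lform_CS (u v : 'rV[R]_N) : lform u v ^+ 2 <= dot u u * dot v v.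
Proof.
apply: le_trans (dot_CS _ _) _; rewrite ler_wpM2r ?dot_ge0//.
by rewrite -/(lform u (u *m hJ)) lform_dot -mulmxA hJK mulmx1.
Qed.

Definition lorentzian (h : 'M[R]_N) : Prop := h *m hJ *m h^T = hJ.

Lemma lform_lorentzian h (u v : 'rV[R]_N) :
  lorentzian h -> lform (u *m h) (v *m h) = lform u v.
Proof.
move=> hh; rewrite /lform !dot_mxE trmx_mul mulmxA.
by rewrite -[u *m h *m hJ]mulmxA -[u *m (h *m hJ) *m _]mulmxA hh.
Qed.

Lemma lorentzian1 : lorentzian 1%:M.
Proof. by rewrite /lorentzian trmx1 mulmx1 mul1mx. Qed.

Lemma lorentzianM h k : lorentzian h -> lorentzian k -> lorentzian (h *m k).
Proof.
move=> hh hk; rewrite /lorentzian trmx_mul mulmxA.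
by rewrite -[h *m k *m hJ]mulmxA -[h *m (k *m hJ) *m _]mulmxA hk.
Qed.

Lemma lorentzian_mulV h : lorentzian h -> h *m (hJ *m h^T *m hJ) = 1%:M.
Proof. by move=> hh; rewrite !mulmxA hh hJK. Qed.

Lemma lorentzian_unit h : lorentzian h -> h \in unitmx.
Proof. by move/lorentzian_mulV/mulmx1_unit => []. Qed.

Lemma lorentzianV h : lorentzian h -> lorentzian (invmx h).
Proof.
move=> hh; rewrite /lorentzian -{1}hh !mulmxA mulVmx ?lorentzian_unit// mul1mx.
by rewrite -mulmxA -trmx_mul mulVmx ?lorentzian_unit// trmx1 mulmx1.
Qed.

Lemma lorentzian_tr h : lorentzian h -> lorentzian h^T.
Proof.
move=> hh; have /mulmx1C := lorentzian_mulV hh.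
move=> /(congr1 (mulmx hJ)); rewrite mulmx1 !mulmxA hJK mul1mx.
by rewrite /lorentzian trmxK.
Qed.

Lemma hvec_inj : injective hvec.
Proof.
move=> p q /eq_row_mx[/matrixP/(_ 0 0)]; rewrite !mxE !mulr1n => h0 h1.
by apply: val_inj; move: h0 h1 => /=;
  case: (hpoint p) (hpoint q) => [a u] [b v] /= -> ->.
Qed.

Lemma hvec00 p : hvec p 0 0 = (hpoint p).1.
Proof.
have := row_splitE (hvec p); rewrite {1}/hvec => /eq_row_mx[/matrixP/(_ 0 0)].
by rewrite !mxE !mulr1n => <-.
Qed.

Lemma hvec0_gt0 p : 0 < hvec p 0 0.
Proof. by rewrite hvec00; have [] := hyperbolicP p. Qed.

Lemma horigin_point : exists o : H, hvec o = horigin.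
Proof.
pose o : R * 'rV[R]_d := (1, 0).
have h : (lorentz o o == -1) && (0 < o.1).
  rewrite /= ltr01 andbT /lorentz /= mulr1 (_ : dot 0 0 = 0) ?sub0r//.
  by rewrite -(scale0r 0) dotZl mul0r.
by exists (Hyperbolic h).
Qed.

Lemma lform_hvec p : lform (hvec p) (hvec p) = -1.
Proof. by rewrite -lorentz_lform; case: p => p /= /andP[/eqP]. Qed.

Lemma lform_hvec_le p q : lform (hvec p) (hvec q) <= -1.
Proof. by have := lorentz_ge1 p q; rewrite lorentz_lform; lra. Qed.

Lemma hvec_exists (u : 'rV[R]_N) : lform u u = -1 ->
  exists p, hvec p = u \/ hvec p = - u.
Proof.
rewrite [u]row_splitE; move: (u 0 0) (rsubmx u) => a v; rewrite lformE => h.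
have a0 : a != 0.
  by apply/eqP => a0; have := dot_ge0 v; move: h; rewrite a0; lra.
have [ap|an] := ltP 0 a.
  have hp : (lorentz (a, v) (a, v) == -1) && (0 < (a, v).1).
    by rewrite /= ap andbT; apply/eqP.
  by exists (Hyperbolic hp); left.
have hp : (lorentz (- a, - v) (- a, - v) == -1) && (0 < (- a, - v).1).
  rewrite /= oppr_gt0 lt_neqAle a0 an !andbT; apply/eqP; rewrite -h.
  by rewrite /lorentz /= !dotE opprK mulrNN.
by exists (Hyperbolic hp); right; rewrite /hvec /= opp_row_mx; congr row_mx;
  apply/matrixP => i j; rewrite !mxE mulNrn.
Qed.

(* [h] may exchange the two sheets of the hyperboloid, so it acts on
   [hyperbolic] only up to sign. *)
Definition hacts (h : 'M[R]_N) (g : H -> H) : Prop :=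
  forall p, hvec (g p) = hvec p *m h \/ hvec (g p) = - (hvec p *m h).

Lemma hacts_exists h : lorentzian h -> exists g, hacts h g.
Proof.
move=> hh; have /choice[g gP] : forall p, exists q,
    hvec q = hvec p *m h \/ hvec q = - (hvec p *m h).
  by move=> p; apply: hvec_exists; rewrite lform_lorentzian// lform_hvec.
by exists g.
Qed.

Lemma hacts_comp h h' g g' : hacts h g -> hacts h' g' ->
  hacts (h *m h') (g' \o g).
Proof.
move=> hg hg' p /=; rewrite mulmxA.
by have [->|->] := hg' (g p); have [->|->] := hg p; rewrite ?mulNmx ?opprK;
  tauto.
Qed.

Lemma hvec_pm p q : hvec p = hvec q \/ hvec p = - hvec q -> p = q.
Proof.
move=> [/hvec_inj//|h]; have := hvec0_gt0 p; rewrite h mxE oppr_gt0.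
by rewrite ltNge (ltW (hvec0_gt0 q)).
Qed.

Lemma hacts1 g : hacts 1%:M g -> g = id.
Proof. by move=> h; apply/funext => p; apply: hvec_pm;
  rewrite -[hvec p]mulmx1. Qed.

(** The signs chosen at [p] and at [q] must agree, because the form of two points of the upper sheet
    is at most -1. *)
Lemma hacts_lform h g p q : lorentzian h -> hacts h g ->
  lform (hvec (g p)) (hvec (g q)) = lform (hvec p) (hvec q).
Proof.
move=> hh hg; have h1 := lform_hvec_le (g p) (g q);
  have h2 := lform_hvec_le p q.
have E : lform (hvec p *m h) (hvec q *m h) = lform (hvec p) (hvec q).
  exact: lform_lorentzian.
have [e1|e1] := hg p; have [e2|e2] := hg q; rewrite e1 e2 in h1 *;
  move: h1; rewrite ?(lformNl, lformNr) E; lra.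
Qed.

Lemma hdist_lform (p q : H) : hdist p q = arcosh (- lform (hvec p) (hvec q)).
Proof. by rewrite /hdist lorentz_lform. Qed.

Lemma hacts_inv h g g' : lorentzian h -> hacts h g -> hacts (invmx h) g' ->
  cancel g g'.
Proof.
move=> hh hg hg' p; have := hacts_comp hg hg'.
by rewrite mulmxV ?lorentzian_unit// => /hacts1 /(congr1 (fun k => k p)).
Qed.

Lemma hacts_isometry h g : lorentzian h -> hacts h g ->
  metric_isometry (g : (H : metricType R) -> H).
Proof.
move=> hh hg; split.
  have [g' hg'] := hacts_exists (lorentzianV hh); exists g'.
    exact: hacts_inv hg hg'.
  apply: (hacts_inv (lorentzianV hh) hg').
  by rewrite invmxK.
by move=> p q; rewrite /mdist /= !hdist_lform (hacts_lform _ _ hh hg).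
Qed.

Lemma lform_origin : lform horigin horigin = -1.
Proof. by rewrite lformE (_ : dot 0 0 =
  0) ?sub0r ?mulr1// -(scale0r 0) dotZl mul0r. Qed.

(* The point reflection in the midpoint of [p] and the origin. *)
Definition midreflection (p : H) : 'M[R]_N :=
  let n := hvec p + horigin in
  (2 / lform n n) *: (hJ *m n^T *m n) - 1%:M.

Lemma lformDl u v w : lform (u + v) w = lform u w + lform v w.
Proof. by rewrite /lform mulmxDl dotDl. Qed.

Lemma lform_origin_hvec u : lform horigin u = - u 0 0.
Proof.
rewrite {1}[u]row_splitE lformE mul1r.
by rewrite (_ : dot 0 _ = 0) ?sub0r// -(scale0r 0) dotZl mul0r.
Qed.

Lemma midreflection_norm p : lform (hvec p + horigin) (hvec p + horigin) < 0.
Proof.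
rewrite lformDl ![lform _ (_ + _)]lformC !lformDl lform_hvec lform_origin.
rewrite [lform (hvec p) _]lformC !lform_origin_hvec.
by have := hvec0_gt0 p; lra.
Qed.

Lemma mul_midreflection p (u : 'rV[R]_N) : let n := hvec p + horigin in
  u *m midreflection p = (2 / lform n n * lform u n) *: n - u.
Proof.
move=> n; rewrite /midreflection -/n mulmxBr mulmx1 -scalemxAr -scalerA;
  congr (_ *: _ - _).
rewrite !mulmxA [X in X *m n]mx11_scalar mul_scalar_mx; congr (_ *: _).
by rewrite /lform dot_mxE.
Qed.

Lemma midreflection_lorentzian p : lorentzian (midreflection p).
Proof.
rewrite /lorentzian /midreflection; set n := hvec p + horigin;
  set c := lform n n.
have c0 : c != 0 by rewrite lt_eqF// midreflection_norm.
have nn : n *m hJ *m n^T = c%:M.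
  by rewrite [LHS]mx11_scalar -dot_mxE.
rewrite linearB /= trmx1 linearZ /= !trmx_mul trmxK hJ_sym.
set X := hJ *m n^T *m n.
have XJ : X *m hJ = hJ *m (n^T *m (n *m hJ)) by rewrite /X !mulmxA.
rewrite mulmxBl mulmxBr mul1mx mulmxBl -!scalemxAl !mulmx1 -!scalemxAr.
have -> : hJ *m (n^T *m (n *m hJ)) = X *m hJ by rewrite XJ.
have -> : X *m hJ *m (n^T *m (n *m hJ)) = c *: (X *m hJ).
  transitivity (hJ *m n^T *m (n *m hJ *m n^T) *m (n *m hJ)).
    by rewrite /X !mulmxA.
  by rewrite nn mul_mx_scalar -scalemxAl /X !mulmxA.
rewrite !scalerA.
have -> : 2 / c * (2 / c) * c = 2 / c + 2 / c by clearbody c; field.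
by rewrite scalerDl addrK subKr.
Qed.

Lemma hvec_midreflection p : hvec p *m midreflection p = horigin.
Proof.
rewrite mul_midreflection; set n := hvec p + horigin.
have c0 : lform n n != 0 by rewrite lt_eqF// midreflection_norm.
have -> : lform (hvec p) n = lform n n / 2.
  rewrite /n lformDl ![lform _ (_ + _)]lformC !lformDl lform_hvec lform_origin.
  rewrite [lform (hvec p) _]lformC; lra.
have -> : 2 / lform n n * (lform n n / 2) = 1 by move: (lform n n) c0 => c c0;
  field.
by rewrite scale1r addrC addKr.
Qed.

Lemma hyperbolic_transitive (x y : H) :
  exists2 f : H -> H, metric_isometry (f : (H : metricType R) -> H) & f x = y.
Proof.
pose h := midreflection x *m invmx (midreflection y).
have hh : lorentzian h.
  by apply: lorentzianM; [|apply: lorentzianV]; exact: midreflection_lorentzian.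
have [f hf] := hacts_exists hh; exists f; first exact: hacts_isometry hf.
apply: hvec_pm; have := hf x; rewrite /h mulmxA hvec_midreflection.
rewrite -(hvec_midreflection y) mulmxK//.
exact: lorentzian_unit (midreflection_lorentzian y).
Qed.

Lemma lform_le_expR (p q : H) (D : R) : hdist p q <= D ->
  - lform (hvec p) (hvec q) <= expR D.
Proof.
move=> pq; have := lform_hvec_le p q; rewrite lerNr => c1.
apply: (@le_trans _ _ (expR (hdist p q))); last by rewrite ler_expR.
rewrite hdist_lform /arcosh lnK ?lerDl ?sqrtr_ge0// posrE.
by rewrite (lt_le_trans ltr01)// arcosh_arg_ge1.
Qed.

Lemma hdist_le_ln (p q : H) (M : R) : - lform (hvec p) (hvec q) <= M ->
  hdist p q <= ln (2 * M).
Proof.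
move=> pq; have := lform_hvec_le p q; rewrite lerNr hdist_lform.
move: (- lform _ _) pq => c cM c1.
rewrite /arcosh ler_ln ?posrE;
  [|by rewrite (lt_le_trans ltr01)// arcosh_arg_ge1|lra].
have : Num.sqrt (c ^+ 2 - 1) <= c.
  rewrite -[leRHS]ger0_norm; last lra.
  by rewrite -sqrtr_sqr ler_wsqrtr// gerBl.
lra.
Qed.

(** For [s <= e^2 / 9] the square root in [arcosh] is at most [e / 2]; the rest is
    [1 + e <= expR e]. *)
Lemma arcosh_lt (s e : R) : 0 < e -> e <= 1 -> 0 <= s -> s <= e ^+ 2 / 9 ->
  arcosh (1 + s) < e.
Proof.
move=> e0 e1 s0 se; rewrite -ltr_expR.
have s1 : 1 <= 1 + s by lra.
rewrite /arcosh lnK ?posrE;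
  last by rewrite (lt_le_trans ltr01)// arcosh_arg_ge1.
apply: lt_le_trans (expR_ge1Dx e).
have -> : (1 + s) ^+ 2 - 1 = 2 * s + s ^+ 2 by ring.
have : Num.sqrt (2 * s + s ^+ 2) <= e / 2.
  rewrite -[leRHS]ger0_norm; last lra.
  rewrite -sqrtr_sqr ler_wsqrtr//.
  have : s <= 1 / 9 by move: se; rewrite expr2; nra.
  move: se; rewrite !expr2; nra.
move: se; rewrite expr2; nra.
Qed.

(** The hyperbolic cosine of the distance exceeds 1 by at most the squared Euclidean distance of the
    spatial parts, so the grid argument applies to these. *)
Lemma hyperbolic_separated : separated_bounded (X := H : metricType R).
Proof.
move=> x0 r eps eps0.
pose e := Num.min eps 1.
have e0 : 0 < e by rewrite lt_min eps0 ltr01.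
have e1 : e <= 1 by rewrite ge_min lexx orbT.
have [p0 p0E] := horigin_point.
pose rho := expR (hdist p0 x0 + r).
(* The factor 3 matches the constant 9 of [arcosh_lt]. *)
pose eta := e / d.+1%:R / 3.
have eta0 : 0 < eta by rewrite !divr_gt0.
have [M MP] := grid_bounded d rho eta0.
exists M => T f f1 f2.
have f0 t : (hpoint (f t)).1 <= rho.
  rewrite -hvec00 -[leLHS]opprK -lform_origin_hvec -p0E lform_le_expR//.
  by apply: le_trans (hdist_triangle x0 _ _) _; rewrite lerD2l; exact: f1.
apply: (MP T (fun t => (hpoint (f t)).2)) => [t i|t t' tt'].
  have [h1 h2] := hyperbolicP (f t).
  have ft0 := f0 t.
  have := coord_le_dot (hpoint (f t)).2 i; rewrite h1 => h3.
  rewrite -[leRHS]ger0_norm ?expR_ge0// -ler_sqr ?nnegrE// !real_normK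
    ?num_real//.
  by move: h2 h3; rewrite !expr2; nra.
apply/not_existsP => far.
have : mdist (f t) (f t') < eps; last by rewrite ltNge f2.
apply: (@lt_le_trans _ _ e); last by rewrite ge_min lexx.
rewrite /mdist /= hdist_lform.
have c1 := lform_hvec_le (f t) (f t').
have [h1 h2] := hyperbolicP (f t); have [h3 h4] := hyperbolicP (f t').
pose u := (hpoint (f t)).2 - (hpoint (f t')).2.
have uE : dot u u <= d%:R * eta ^+ 2.
  by apply: dot_le_sup => i; rewrite !mxE ltW// ltNge; apply/negP/far.
have -> : - lform (hvec (f t)) (hvec (f t')) =
  1 + (- lform (hvec (f t)) (hvec (f t')) - 1) by ring.
apply: arcosh_lt => //; first lra.
apply: (@le_trans _ _ (d%:R * eta ^+ 2)).
  apply: le_trans uE; rewrite /u lformE !dotE h1 h3 (dotC (hpoint (f t')).2 _).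
  move: (dot_ge0 u); rewrite /u !dotE h1 h3 (dotC (hpoint (f t')).2 _).
  move: (hpoint (f t)).1 (hpoint (f t')).1 (dot _ _) => a b w.
  by have := sqr_ge0 (a - b); rewrite !expr2; lra.
have -> : e ^+ 2 / 9 = d.+1%:R ^+ 2 * eta ^+ 2 by rewrite /eta; field.
rewrite ler_pM2r ?exprn_gt0// -natrX ler_nat; nia.
Qed.

End HyperbolicGeometry.

(** * Congruence subgroups of an arithmetic lattice *)

Section ArithmeticLattice.
Context {R : realType} {d : nat}.
Local Notation H := (hyperbolic R d).
Local Notation N := (1 + d)%N.
Local Notation toR := (map_mx (intr : int -> R)).
Local Notation s2 := (Num.sqrt 2 : R).
Local Notation hJ := (@hJ R d).

(** * Arithmetic of [Z[sqrt 2]] and its two embeddings *)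

Lemma sqr_sqrt2 : s2 ^+ 2 = 2.
Proof. by rewrite sqr_sqrtr. Qed.

(** Otherwise the exponent of 2 would be even on one side and odd on the other. *)
Lemma int_sqrt2 (a b : int) : a ^+ 2 = 2 * b ^+ 2 -> a = 0 /\ b = 0.
Proof.
move=> ab; have abn : (`|a| ^ 2 = 2 * `|b| ^ 2)%N.
  by apply/eqP; rewrite -eqz_nat; apply/eqP;
    rewrite PoszM -!abszX !gez0_abs ?sqr_ge0.
have [b0|b0] := eqVneq b 0.
  by split => //; move: ab; rewrite b0 expr0n mulr0 => /eqP;
    rewrite sqrf_eq0 => /eqP.
have a0 : a != 0.
  by apply: contra_neq b0 => a0; apply/eqP; move/eqP: ab;
    rewrite a0 expr0n eq_sym mulf_eq0 sqrf_eq0.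
have := congr1 (fun n => odd (logn 2 n)) abn.
rewrite /= lognM ?expn_gt0 ?absz_gt0 ?b0// !lognX oddD /=.
by rewrite /= !mul2n !odd_double.
Qed.

Lemma sqrt2_free (a b : int) : a%:~R + s2 * b%:~R = 0 :> R -> a = 0 /\ b = 0.
Proof.
move=> ab; apply: int_sqrt2; apply: (@intr_inj R).
have -> : (a ^+ 2)%:~R = (- (s2 * b%:~R)) ^+ 2 :> R.
  by rewrite rmorphXn /=; congr (_ ^+ 2); move: ab; lra.
by rewrite sqrrN exprMn sqr_sqrt2 intrM rmorphXn.
Qed.

(** The fourth root of 2 on the first coordinate turns the standard Lorentz form into
    [- sqrt 2 x_0^2 + x_1^2 + ... + x_d^2], and the scalar product into the conjugate of that
    form. *)
Definition hscale : 'M[R]_N := block_mx (Num.sqrt s2)%:M 0 0 1%:M.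

Lemma hscale_unit : hscale \in unitmx.
Proof.
rewrite unitmxE det_ublock det_scalar1 det1 mulr1 unitfE sqrtr_eq0 -ltNge.
by rewrite sqrtr_gt0 ltr0n.
Qed.

(* The two real embeddings of [Z[sqrt 2]^N], written over [Z^(N + N)]; they
   carry the standard Lorentz form and the standard scalar product to the two
   conjugates of [- sqrt 2 x_0^2 + x_1^2 + ... + x_d^2]. *)
Definition embP : 'M[R]_(N + N, N) := col_mx hscale (s2 *: hscale).
Definition embQ : 'M[R]_(N + N, N) := col_mx hscale (- s2 *: hscale).

Local Notation P := embP.
Local Notation Q := embQ.

Definition unitI : 'M[int]_N := block_mx 0 0 0 1%:M.
Definition unit0 : 'M[int]_N := block_mx 1%:M 0 0 0.

(* [Phi1 + sqrt 2 Phi2] is the Gram matrix of that form over [Z^(N + N)], and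
   [Psi] is [2 Phi1^-1]. *)
Definition Phi1 : 'M[int]_(N + N) :=
  block_mx unitI (- 2 *: unit0) (- 2 *: unit0) (2 *: unitI).
Definition Phi2 : 'M[int]_(N + N) :=
  block_mx (- unit0) unitI unitI (- 2 *: unit0).
Definition Psi : 'M[int]_(N + N) :=
  block_mx (2 *: unitI) (- unit0) (- unit0) unitI.

Lemma s2_ss : s2 * s2 = 2.
Proof. by rewrite -expr2 sqr_sqrt2. Qed.

Lemma hscale_lform : hscale *m hJ *m hscale^T = toR unitI - s2 *: toR unit0.
Proof.
rewrite /hscale /hJ tr_block_mx !trmx0 !tr_scalar_mx !mulmx_block.
rewrite !(mulmx0, mul0mx, addr0, add0r, mulmx1) -!scalar_mxM.
rewrite /unitI /unit0 !map_block_mx !map_mx0 !map_mx1.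
rewrite scale_block_mx opp_block_mx add_block_mx !scaler0 !oppr0 !addr0 add0r.
congr block_mx; apply/matrixP => i j; rewrite !mxE.
have : Num.sqrt s2 * Num.sqrt s2 = s2 by rewrite -expr2 sqr_sqrtr ?sqrtr_ge0.
move: (Num.sqrt s2) s2 => q s qs.
by case: (i == j); ring: qs.
Qed.

Lemma hscale_dot : hscale *m hscale^T = toR unitI + s2 *: toR unit0.
Proof.
rewrite /hscale tr_block_mx !trmx0 !tr_scalar_mx !mulmx_block.
rewrite !(mulmx0, mul0mx, addr0, add0r, mulmx1) -!scalar_mxM.
rewrite /unitI /unit0 !map_block_mx !map_mx0 !map_mx1.
rewrite scale_block_mx add_block_mx !scaler0 !addr0 add0r.
by rewrite -expr2 sqr_sqrtr ?sqrtr_ge0// scale_scalar_mx mulr1.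
Qed.

Lemma embP_form : embP *m hJ *m embP^T = toR Phi1 + s2 *: toR Phi2.
Proof.
rewrite /embP tr_col_mx mul_col_mx mul_col_row linearZ /= -!scalemxAl
  -!scalemxAr.
rewrite hscale_lform /Phi1 /Phi2; move: unitI unit0 => A B.
rewrite !map_block_mx !map_mxZ !map_mxN /=.
rewrite scale_block_mx add_block_mx.
congr block_mx; apply/matrixP => i j; rewrite !mxE; have := s2_ss;
  move: s2 => s ss; ring: ss.
Qed.

Lemma embQ_form : embQ *m embQ^T = toR Phi1 - s2 *: toR Phi2.
Proof.
rewrite /embQ tr_col_mx mul_col_row linearZ /= -!scalemxAl -!scalemxAr.
rewrite hscale_dot /Phi1 /Phi2; move: unitI unit0 => A B.
rewrite !map_block_mx !map_mxZ !map_mxN /=.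
rewrite scale_block_mx opp_block_mx add_block_mx.
congr block_mx; apply/matrixP => i j; rewrite !mxE; have := s2_ss;
  move: s2 => s ss; ring: ss.
Qed.

Lemma Phi1_Psi : 2 *: (Phi1 *m Psi) = 4%:M.
Proof.
have II : unitI *m unitI = unitI.
  by rewrite /unitI mulmx_block !mulmx0 !mul0mx !addr0 !add0r mulmx1.
have EE : unit0 *m unit0 = unit0.
  by rewrite /unit0 mulmx_block !mulmx0 !mul0mx !addr0 mulmx1.
have IE : unitI *m unit0 = 0.
  by rewrite /unit0 /unitI mulmx_block !mulmx0 !mul0mx !addr0 -block_mx0.
have EI : unit0 *m unitI = 0.
  by rewrite /unit0 /unitI mulmx_block !mulmx0 !mul0mx !addr0 -block_mx0.
have IpE : unitI + unit0 = 1%:M.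
  by rewrite /unit0 /unitI add_block_mx !addr0 add0r -scalar_mx_block.
rewrite /Phi1 /Psi mulmx_block scale_block_mx scalar_mx_block.
rewrite !(mulmxN, mulNmx) -!scalemxAl -!scalemxAr II EE IE EI.
rewrite !(scaler0, oppr0, addr0, add0r).
have -> : (4%:M : 'M[int]_N) = 4 *: (unitI + unit0) by rewrite IpE scalemx1.
by congr block_mx; apply/matrixP => i j; rewrite !mxE; ring.
Qed.

Lemma Psi_sym : Psi^T = Psi.
Proof.
rewrite /Psi tr_block_mx !linearN !linearZ /=.
have -> : unitI^T = unitI by rewrite /unitI tr_block_mx !trmx0 trmx1.
by have -> : unit0^T = unit0 by rewrite /unit0 tr_block_mx !trmx0 trmx1.
Qed.

Lemma Phi1_sym : Phi1^T = Phi1.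
Proof.
rewrite /Phi1 tr_block_mx !linearZ /=.
have -> : unitI^T = unitI by rewrite /unitI tr_block_mx !trmx0 trmx1.
by have -> : unit0^T = unit0 by rewrite /unit0 tr_block_mx !trmx0 trmx1.
Qed.

Lemma Psi_Phi1 : 2 *: (Psi *m Phi1) = 4%:M.
Proof.
have := congr1 trmx Phi1_Psi.
by rewrite tr_scalar_mx linearZ /= trmx_mul Psi_sym Phi1_sym.
Qed.

(* [L] is a left inverse of the embedding [P], so [P *m L] is a projector with
   kernel the radical of the form pulled back along [P]. *)
Lemma descend_isometry n (P : 'M[R]_(n, N)) (L : 'M[R]_(N, n)) (J :
  'M[R]_N) (A : 'M[R]_n) :
  L *m P = 1%:M -> J \in unitmx -> A \in unitmx ->
  A *m (P *m J *m P^T) *m A^T = P *m J *m P^T ->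
  exists2 h, A *m P = P *m h & h *m J *m h^T = J.
Proof.
move=> LP uJ uA AP.
have PL : P^T *m L^T = 1%:M by rewrite -trmx_mul LP trmx1.
have E : A *m P = P *m (L *m A *m P).
  pose T := 1%:M - P *m L.
  have TP : T *m P = 0 by rewrite mulmxBl mul1mx -mulmxA LP mulmx1 subrr.
  (* [T] kills [P] and hence the form preserved by [A]; the factors [A^T], [P^T] and [J] then cancel
     on the right. *)
  have : T *m A *m P = 0.
    have : T *m (A *m (P *m J *m P^T) *m A^T) = 0.
      by rewrite AP !mulmxA TP !mul0mx.
    move/(congr1 (fun M => M *m invmx A^T *m L^T *m invmx J)).
    rewrite !mul0mx !mulmxA mulmxK ?unitmx_tr//.
    by rewrite -[_ *m P^T *m L^T]mulmxA PL mulmx1 mulmxK.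
  by rewrite /T !mulmxBl mul1mx => /eqP; rewrite subr_eq0 => /eqP ->;
    rewrite !mulmxA.
exists (L *m A *m P) => //; move: (L *m A *m P) E => h E.
have : P *m (h *m J *m h^T) *m P^T = P *m J *m P^T.
  transitivity (P *m h *m J *m (P *m h)^T);
    first by rewrite (trmx_mul P h) !mulmxA.
  by rewrite -E trmx_mul -[RHS]AP !mulmxA.
move/(congr1 (fun M => L *m M *m L^T)).
by rewrite !mulmxA LP !mul1mx -!mulmxA PL !mulmx1.
Qed.

Definition iform (A : 'M[int]_(N + N)) (y z : 'rV[int]_(N + N)) : int :=
  (y *m A *m z^T) 0 0.

Lemma iform_toR A y z : (iform A y z)%:~R =
  (toR y *m toR A *m (toR z)^T) 0 0 :> R.
Proof. by rewrite /iform map_trmx -!map_mxM [RHS]mxE. Qed.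

Lemma lform_embP (y z : 'rV[int]_(N + N)) :
  lform (toR y *m P) (toR z *m P) =
  (iform Phi1 y z)%:~R + s2 * (iform Phi2 y z)%:~R.
Proof.
rewrite /lform dot_mxE trmx_mul !iform_toR.
transitivity ((toR y *m (P *m hJ *m P^T) *m (toR z)^T) 0 0);
  first by rewrite !mulmxA.
by rewrite embP_form mulmxDr mulmxDl -scalemxAr -scalemxAl mxE; congr (_ + _);
  rewrite mxE.
Qed.

Lemma dot_embQ (y z : 'rV[int]_(N + N)) :
  dot (toR y *m Q) (toR z *m Q) =
  (iform Phi1 y z)%:~R - s2 * (iform Phi2 y z)%:~R.
Proof.
rewrite dot_mxE trmx_mul !iform_toR.
transitivity ((toR y *m (Q *m Q^T) *m (toR z)^T) 0 0); first by rewrite !mulmxA.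
rewrite embQ_form mulmxBr mulmxBl -scalemxAr -scalemxAl mxE; congr (_ + _).
by rewrite mxE; congr (- _); rewrite mxE.
Qed.

Lemma sqrt2_mx_free m n (a b : 'M[int]_(m, n)) : toR a - s2 *: toR b = 0 ->
  a = 0 /\ b = 0.
Proof.
move=> /matrixP ab; have h i j : a i j = 0 /\ - b i j = 0.
  by apply: (sqrt2_free); have := ab i j; rewrite !mxE rmorphN mulrN.
split; apply/matrixP => i j; rewrite mxE; have [h1 h2] := h i j => //.
by apply: oppr_inj; rewrite oppr0.
Qed.

Lemma embQ_inj (z : 'rV[int]_(N + N)) : toR z *m Q = 0 -> z = 0.
Proof.
rewrite -[z]hsubmxK map_row_mx mul_row_col -scalemxAr scaleNr scalemxAl
  -mulmxBl.
move/(congr1 (mulmx^~ (invmx hscale))); rewrite mulmxK ?hscale_unit// mul0mx.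
by move/sqrt2_mx_free => [-> ->]; rewrite row_mx0.
Qed.

(* The form is anisotropic over [Z[sqrt 2]] and its norm to [Z] is an integer:
   a vector short in one embedding is long in the other. *)
Lemma lattice_min g (z : 'rV[int]_(N + N)) : lorentzian g -> z != 0 ->
  2 <= dot (toR z *m P *m g) (toR z *m P *m g) + dot (toR z *m Q) (toR z *m Q).
Proof.
move=> hg z0.
set p := dot (toR z *m P *m g) _; set q := dot (toR z *m Q) _.
have q0 : q != 0.
  by apply: contra_neq z0 => /dot_eq0/embQ_inj.
have qp : 0 < q by rewrite lt_neqAle eq_sym q0 dot_ge0.
have p0 : 0 <= p by exact: dot_ge0.
have lp : lform (toR z *m P) (toR z *m P) ^+ 2 <= p ^+ 2.
  by rewrite -(lform_lorentzian _ _ hg) [p ^+ 2]expr2; exact: lform_CS.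
(* The values of the two conjugate forms multiply to the norm [a^2 - 2 b^2], a nonzero integer. The
   inequality between the means then gives [p + q >= 2]. *)
have pq : 1 <= (p * q) ^+ 2.
  apply: (@le_trans _ _ ((lform (toR z *m P) (toR z *m P) * q) ^+ 2));
    last first.
    by rewrite !exprMn ler_wpM2r ?sqr_ge0.
  rewrite lform_embP /q dot_embQ.
  set a := iform _ _ _; set b := iform _ _ _.
  have -> : (a%:~R + s2 * b%:~R) * (a%:~R - s2 * b%:~R) =
    (a ^+ 2 - 2 * b ^+ 2)%:~R :> R.
    by rewrite intrB (intrM R 2) !rmorphXn /= [LHS]mulrC -subr_sqr exprMn
      sqr_sqrt2.
  have ab : a ^+ 2 - 2 * b ^+ 2 != 0.
    apply: contra_neq q0 => /eqP; rewrite subr_eq0 => /eqP /int_sqrt2[a0 b0].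
    by rewrite /q dot_embQ -/a -/b a0 b0 mulr0 subr0.
  rewrite -rmorphXn /= -[1]/(1%:~R) ler_int; move: ab; move: (_ - _) => u;
    rewrite expr2; nia.
have pq1 : 1 <= p * q by rewrite -(@expr_ge1 _ 2)// mulr_ge0// ltW.
have : (p + q) ^+ 2 = (p - q) ^+ 2 + 4 * (p * q) by ring.
have := sqr_ge0 (p - q); rewrite !expr2 => h1 h2.
have pq0 : 0 < p + q by lra.
nra.
Qed.

(** A basis of [Z[sqrt 2]^N] under both real embeddings, with [g] applied in the Lorentzian one. For
    a [g] taking a point to the origin, this is the Euclidean lattice attached to the point. *)
Definition emb_basis (g : 'M[R]_N) : 'M[R]_(N + N, N + N) := row_mx (P *m g) Q.

Lemma emb_basis_dot g (u v : 'rV[R]_(N + N)) :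
  dot (u *m emb_basis g) (v *m emb_basis g) =
  dot (u *m P *m g) (v *m P *m g) + dot (u *m Q) (v *m Q).
Proof. by rewrite /emb_basis !mul_mx_row dot_row_mx !mulmxA. Qed.

(** Up to the isometry [J2] and the factor 1/4, the dual lattice lies in the lattice itself. Thus
    [lattice_min] bounds its squared lengths below by [2 / 16 = 1 / 8], uniformly in [g]. *)
Lemma emb_basis_reduced : exists C : R, forall g, lorentzian g ->
  exists2 U : 'M[int]_(N + N), U \in unitmx & forall i,
    dot (row i (toR U *m P *m g)) (row i (toR U *m P *m g)) +
    dot (row i (toR U *m Q)) (row i (toR U *m Q)) <= C.
Proof.
have [|C HC] := @short_basisP R (N + N) (1 / 8); first by lra.
exists C => g hg.
pose B := emb_basis g.
pose J2 : 'M[R]_(N + N) := block_mx hJ 0 0 1%:M.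
have J2_sym : J2^T = J2 by rewrite /J2 tr_block_mx !trmx0 trmx1 hJ_sym.
have J2K : J2 *m J2 = 1%:M.
  by rewrite /J2 mulmx_block !(mulmx0, mul0mx, addr0, add0r) mulmx1 hJK
    -scalar_mx_block.
(* Adding the two conjugate Gram matrices cancels the [sqrt 2] parts. *)
have BJ : B *m J2 *m B^T = 2 *: toR Phi1.
  rewrite /B /emb_basis /J2 mul_row_block !(mulmx0, addr0, add0r) mulmx1
    tr_row_mx mul_row_col.
  rewrite trmx_mul !mulmxA -[P *m g *m hJ]mulmxA -[P *m (g *m hJ) *m _]mulmxA
    hg.
  by rewrite embP_form embQ_form addrACA subrr addr0 -mulr2n scaler_nat.
pose D := 4^-1 *: (toR Psi *m B *m J2).
have BD : B *m D^T = 1%:M.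
  rewrite /D linearZ /= !trmx_mul J2_sym map_trmx Psi_sym -scalemxAr !mulmxA BJ.
  rewrite -scalemxAl -map_mxM.
  have := congr1 toR Phi1_Psi; rewrite map_mxZ map_scalar_mx /= => ->.
  by rewrite scale_scalar_mx mulVf// pnatr_eq0.
have DB : D^T *m B = 1%:M by exact: mulmx1C.
have DA : D = (D *m D^T) *m B by rewrite -mulmxA DB mulmx1.
have [|U uU UC] := HC _ D B _ BD DA.
  move=> y y0.
  have yPsi : y *m Psi != 0.
    apply: contra_neq y0 => yP.
    have : y *m (2 *: (Psi *m Phi1)) =
      0 by rewrite -scalemxAr mulmxA yP mul0mx scaler0.
    rewrite Psi_Phi1 mul_mx_scalar => /rowP y4; apply/rowP => i.
    have : 4 * y 0 i = 0 by have := y4 i; rewrite !mxE.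
    by rewrite mxE => /eqP; rewrite mulf_eq0 => /orP[//|/eqP].
  have -> : toR y *m D = 4^-1 *: (toR (y *m Psi) *m B *m J2).
    by rewrite /D -scalemxAr map_mxM !mulmxA.
  have dJ (u : 'rV[R]_(N + N)) : dot (u *m J2) (u *m J2) = dot u u.
    by rewrite !dot_mxE trmx_mul J2_sym mulmxA -[u *m J2 *m J2]mulmxA J2K
      mulmx1.
  rewrite !dotE dJ emb_basis_dot; have := lattice_min hg yPsi; lra.
exists U => // i; apply: le_trans (UC i).
by rewrite !row_mul emb_basis_dot.
Qed.

(** * Traces of Lorentz matrices *)

Lemma row_mx00 (a : R) (v : 'rV[R]_d) : row_mx a%:M v 0 0 = a.
Proof.
have := row_splitE (row_mx a%:M v) => /eq_row_mx[/matrixP/(_ 0 0)].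
by rewrite !mxE !mulr1n => <-.
Qed.

Lemma lform_self (u : 'rV[R]_N) : lform u u = dot u u - 2 * u 0 0 ^+ 2.
Proof.
rewrite [u]row_splitE; move: (u 0 0) (rsubmx u) => a v.
by rewrite row_mx00 lformE dot_row_mx dot_scalar; ring.
Qed.

Lemma coord2_le_dot n (u : 'rV[R]_n) i j : i != j ->
  u 0 i ^+ 2 + u 0 j ^+ 2 <= dot u u.
Proof.
move=> ij; rewrite /dot (bigD1 i)//= (bigD1 j) 1?eq_sym//= -!expr2 addrA lerDl.
by apply: sumr_ge0 => k _; rewrite -expr2 sqr_ge0.
Qed.

Lemma lorentzian_rows (h : 'M[R]_N) i j : lorentzian h ->
  lform (row i h) (row j h) = hJ i j.
Proof.
move=> hh; rewrite /lform /dot -row_mul -[in RHS]hh [RHS]mxE.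
by apply: eq_bigr => k _; rewrite !mxE.
Qed.

Lemma ord0_lshift : (0 : 'I_N) = lshift d 0.
Proof. exact: val_inj. Qed.

Lemma hJ00 : hJ 0 0 = -1.
Proof. by rewrite /hJ ord0_lshift block_mxEul mxE. Qed.

Lemma hJ_diag (i : 'I_N) : i != 0 -> hJ i i = 1.
Proof.
case: (split_ordP i) => j -> jn0; last by rewrite /hJ block_mxEdr mxE eqxx.
by move: jn0; rewrite ord1 ord0_lshift eqxx.
Qed.

(** For [j != 0], row 0 gives [h_0j^2 <= h_00^2 - 1], and column [j] gives
    [h_jj^2 <= 1 + h_0j^2]. *)
Lemma lorentzian_diag_le (h : 'M[R]_N) j : lorentzian h ->
  h j j ^+ 2 <= h 0 0 ^+ 2.
Proof.
move=> hh; have [->//|j0] := eqVneq j 0.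
have := lorentzian_rows 0 0 hh; rewrite hJ00 lform_self mxE => h1.
have := lorentzian_rows j j (lorentzian_tr hh);
  rewrite (hJ_diag j0) lform_self !mxE => h2.
have := coord2_le_dot (row 0 h) j0; have := coord2_le_dot (row j h^T) j0.
by rewrite !mxE; lra.
Qed.

(** Conjugating by a reflection that moves [x] to the origin keeps the trace and makes the corner
    entry, up to sign, the hyperbolic cosine of the displacement of [x]; this entry dominates the
    diagonal. *)
Lemma lorentzian_trace_le (h : 'M[R]_N) (x y : H) :
  lorentzian h -> hvec y = hvec x *m h \/ hvec y = - (hvec x *m h) ->
  `|\tr h| <= N%:R * - lform (hvec x) (hvec y).
Proof.
move=> hh hy; pose s := midreflection x.
have hs : lorentzian s := midreflection_lorentzian x.
pose h' := invmx s *m h *m s.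
have hh' : lorentzian h'.
  by apply: lorentzianM => //; apply: lorentzianM => //; exact: lorentzianV.
have -> : \tr h = \tr h'.
  by rewrite /h' mxtrace_mulC mulmxA mulmxV ?lorentzian_unit// mul1mx.
have h00 : `|h' 0 0| = - lform (hvec x) (hvec y).
  have -> : h' 0 0 = - lform horigin (horigin *m h').
    rewrite lform_origin_hvec opprK /horigin.
    rewrite (_ : row_mx 1%:M 0 = row 0 1%:M); last first.
      apply/rowP => j; case: (split_ordP j) => k ->.
        by rewrite ord1 row_mxEl -ord0_lshift !mxE.
      by rewrite row_mxEr !mxE.
    by rewrite -row_mul mul1mx [RHS]mxE.
  rewrite -(hvec_midreflection x) -/s /h' !mulmxA mulmxK ?lorentzian_unit//.
  rewrite lform_lorentzian// normrN.
  have := lform_hvec_le x y.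
  by case: hy => ->; rewrite ?lformNr => hle;
    [rewrite ler0_norm|rewrite ger0_norm ?opprK]; lra.
rewrite -h00; apply: le_trans (ler_norm_sum _ _ _) _.
have -> : N%:R * `|h' 0 0| = \sum_(i < N) `|h' 0 0|.
  by rewrite sumr_const card_ord mulr_natl.
apply: ler_sum => j _.
by rewrite -[X in X <= _]sqrtr_sqr -[X in _ <=
  X]sqrtr_sqr ler_wsqrtr ?lorentzian_diag_le.
Qed.

(** [A] is the integral matrix of the isometry; [h] and [k] are its images under the two embeddings,
    Lorentzian in the first and orthogonal in the second. *)
Record congruence_isometry (m : nat) (g : H -> H) (A Z : 'M[int]_(N + N))
    (h k : 'M[R]_N) : Prop := CongruenceIsometry {
  ci_congr : A = 1%:M + m%:Z *: Z;
  ci_unit : A \in unitmx;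
  ci_P : toR A *m P = P *m h;
  ci_Q : toR A *m Q = Q *m k;
  ci_h : lorentzian h;
  ci_k : k *m k^T = 1%:M;
  ci_acts : hacts h g }.

Definition congruence_group (m : nat) : set (H -> H) :=
  [set g | exists A Z h k, congruence_isometry m g A Z h k].

Lemma congruence_group_isometry m :
  isometry_group (X := H : metricType R) (congruence_group m).
Proof.
split.
- by move=> g [A [Z [h [k [_ _ _ _ hh _ hg]]]]]; exact: hacts_isometry hg.
- exists 1%:M, 0, 1%:M, 1%:M; split.
  + by rewrite scaler0 addr0.
  + exact: unitmx1.
  + by rewrite map_mx1 mul1mx mulmx1.
  + by rewrite map_mx1 mul1mx mulmx1.
  + exact: lorentzian1.
  + by rewrite trmx1 mulmx1.
  + by move=> p; left; rewrite mulmx1.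
- move=> g g' [A [Z [h [k [AZ uA AP AQ hh kk hg]]]]].
  move=> [A' [Z' [h' [k' [AZ' uA' AP' AQ' hh' kk' hg']]]]].
  exists (A' *m A), (Z' + Z + m%:Z *: (Z' *m Z)), (h' *m h), (k' *m k); split.
  + rewrite AZ AZ' mulmxDl mul1mx mulmxDr mulmx1 -!scalemxAl -!scalemxAr.
    by rewrite !scalerDr -!addrA; congr (_ + _); rewrite addrCA.
  + by rewrite unitmx_mul uA'.
  + by rewrite map_mxM -mulmxA AP mulmxA AP' mulmxA.
  + by rewrite map_mxM -mulmxA AQ mulmxA AQ' mulmxA.
  + exact: lorentzianM.
  + by rewrite trmx_mul mulmxA -[k' *m k *m _]mulmxA kk mulmx1.
  + exact: hacts_comp.
- move=> g [A [Z [h [k [AZ uA AP AQ hh kk hg]]]]].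
  have [g' hg'] := hacts_exists (lorentzianV hh).
  have uh := lorentzian_unit hh; have [uk _] := mulmx1_unit kk.
  exists g'; last first.
    split; first exact: hacts_inv hg hg'.
    by apply: (hacts_inv (lorentzianV hh) hg'); rewrite invmxK.
  have uAR := unit_toR (R := R) uA.
  have iA : toR (invmx A) = invmx (toR A).
    rewrite -[RHS]mul1mx; apply: (canRL (mulmxK uAR)).
    by rewrite -map_mxM mulVmx// map_mx1.
  exists (invmx A), (- (invmx A *m Z)), (invmx h), (invmx k); split => //.
  + apply: (can_inj (mulKmx uA)); rewrite mulmxV// mulmxDr mulmx1 -scalemxAr.
    by rewrite mulmxN mulKVmx// scalerN {1}AZ addrK.
  + by rewrite unitmx_inv.
  + rewrite iA; apply: (can_inj (mulKmx uAR)).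
    by rewrite mulKVmx// mulmxA AP mulmxK.
  + rewrite iA; apply: (can_inj (mulKmx uAR)).
    by rewrite mulKVmx// mulmxA AQ mulmxK.
  + exact: lorentzianV.
  + have kT : invmx k = k^T.
      by rewrite -[LHS]mulmx1 -kk mulmxA mulVmx// mul1mx.
    by rewrite kT trmxK; exact: mulmx1C.
Qed.

(** For [s] equal to [sqrt 2] or its negative, the upper blocks of [A] are the two parts of a matrix
    over [Z[sqrt 2]], which [hscale] conjugates to [h]. *)
Lemma emb_upper (s : R) (A : 'M[R]_(N + N)) (h : 'M[R]_N) :
  A *m col_mx hscale (s *: hscale) = col_mx hscale (s *: hscale) *m h ->
  hscale *m h = (ulsubmx A + s *: ursubmx A) *m hscale.
Proof.
rewrite -{1}[A]submxK mul_block_col mul_col_mx => /eq_col_mx[<- _].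
by rewrite mulmxDl -scalemxAl -scalemxAr.
Qed.

Lemma emb_trace (s : R) m (A Z : 'M[int]_(N + N)) (h : 'M[R]_N) :
  A = 1%:M + m%:Z *: Z ->
  toR A *m col_mx hscale (s *: hscale) = col_mx hscale (s *: hscale) *m h ->
  \tr h = N%:R + m%:R * ((\tr (ulsubmx Z))%:~R + s * (\tr (ursubmx Z))%:~R).
Proof.
move=> AZ /emb_upper Ah.
have -> : h = invmx hscale *m ((ulsubmx (toR A) + s *:
  ursubmx (toR A)) *m hscale).
  by rewrite -Ah mulKmx// hscale_unit.
rewrite mxtrace_mulC -mulmxA mulmxV ?hscale_unit// mulmx1.
rewrite -map_ulsubmx -map_ursubmx AZ.
have -> : ulsubmx (1%:M + m%:Z *: Z) = 1%:M + m%:Z *: ulsubmx Z.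
  by apply/matrixP => i j; rewrite !mxE (inj_eq (@lshift_inj _ _)).
have -> : ursubmx (1%:M + m%:Z *: Z) = m%:Z *: ursubmx Z.
  by apply/matrixP => i j; rewrite !mxE eq_lrshift add0r.
rewrite map_mxD map_mx1 !map_mxZ /= !mxtraceD !mxtraceZ mxtrace1.
by rewrite !trace_map_mx; ring.
Qed.

Lemma congruence_group_displaces (D : R) :
  exists m : nat, displaces (X := H : metricType R) (congruence_group m.+1) D.
Proof.
(* [c] bounds [|\tr h - N|] and [2 N] bounds [|\tr k - N|]; [b] is the product of these bounds. *)
pose c := N%:R * expR D + N%:R.
have c0 : 0 <= c by rewrite addr_ge0// mulr_ge0// expR_ge0.
pose b := c * (N%:R + N%:R).
have b0 : 0 <= b by rewrite mulr_ge0// addr_ge0.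
exists `|Num.floor b|%N => g x [A [Z [h [k [AZ uA AP AQ hh kk hg]]]]] gx.
set m := (`|_|.+1)%N in AZ.
have mb : b < m%:R.
  apply: lt_le_trans (floorD1_gt b) _; rewrite pmulrn ler_int /m.
  have : 0 <= Num.floor b by rewrite floor_ge0.
  move: (Num.floor b) => z; lia.
have := emb_trace AZ AP; have := emb_trace AZ AQ.
set a := \tr (ulsubmx Z); set e := \tr (ursubmx Z); rewrite mulNr => trk trh.
have th : `|\tr h| <= N%:R * expR D.
  apply: le_trans (lorentzian_trace_le hh (hg x)) _.
  by rewrite ler_wpM2l// lform_le_expR.
have krow i : dot (row i k) (row i k) = 1.
  have := congr1 (fun M : 'M[R]_N => M i i) kk; rewrite !mxE eqxx mulr1n => <-.
  by apply: eq_bigr => j _; rewrite !mxE.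
have kdiag i : `|k i i| <= 1.
  rewrite -(@expr_le1 _ 2)// real_normK ?num_real//.
  by have := coord_le_dot (row i k) i; rewrite krow mxE.
have tk : `|\tr k| <= N%:R.
  apply: le_trans (ler_norm_sum _ _ _) _.
  by rewrite -[N in leRHS]card_ord -sumr_const; apply: ler_sum => j _.
(* Otherwise [u v] is a nonzero integer, and [m <= m^2 |u v| <= b < m]. *)
have ae : a = 0 /\ e = 0.
  apply: int_sqrt2; apply/eqP; rewrite -subr_eq0; apply/negPn/negP => ae.
  pose u := a%:~R + s2 * e%:~R; pose v := a%:~R - s2 * e%:~R.
  have uv : 1 <= `|u * v|.
    have -> : u * v = (a ^+ 2 - 2 * e ^+ 2)%:~R.
      by rewrite intrB (intrM R 2) !rmorphXn /= [LHS]mulrC -subr_sqr exprMn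
        sqr_sqrt2.
    by rewrite -intr_norm -[1]/(1%:~R) ler_int; move: ae; move: (_ - _) => w;
      lia.
  have mu : m%:R * `|u| <= c.
    have -> : m%:R * `|u| =
      `|\tr h - N%:R| by rewrite trh addrC addKr normrM normr_nat.
    by apply: le_trans (ler_normB _ _) _; rewrite normr_nat lerD2r.
  have mv : m%:R * `|v| <= N%:R + N%:R.
    have -> : m%:R * `|v| =
      `|\tr k - N%:R| by rewrite trk addrC addKr normrM normr_nat.
    by apply: le_trans (ler_normB _ _) _; rewrite normr_nat lerD2r.
  have m1 : 1 <= m%:R :> R by rewrite ler1n.
  have : (m%:R * `|u|) * (m%:R * `|v|) <= b by rewrite ler_pM// mulr_ge0.
  have -> : (m%:R * `|u|) * (m%:R * `|v|) =
    m%:R * (m%:R * `|u * v|) by rewrite normrM; ring.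
  have : m%:R <= m%:R * (m%:R * `|u * v|) by rewrite ler_peMr// mulr_ege1.
  by lra.
have trkN : \tr k = N%:R by rewrite trk ae.1 ae.2 mulr0 subr0 mulr0 addr0.
(* The diagonal entries are at most 1 and add up to [N], so each is 1; as the rows have length 1,
   the other entries vanish. *)
have k1 : k = 1%:M.
  have : \sum_i (1 - k i i) = 0.
    by rewrite sumrB -[\sum_i k i i]/(\tr k) trkN sumr_const card_ord subrr.
  move=> /eqP; rewrite psumr_eq0 => [/allP kii|i _]; last first.
    by rewrite subr_ge0; apply: le_trans (ler_norm _) (kdiag i).
  have {}kii i : k i i = 1.
    by apply/esym/eqP; rewrite -subr_eq0; exact: (kii i (mem_index_enum i)).
  apply/matrixP => i j; rewrite mxE; have [<-|ij] := eqVneq i j;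
    first exact: kii.
  have := coord2_le_dot (row i k) ij; rewrite krow !mxE kii expr1n gerDl => h0.
  by apply/eqP; rewrite -sqrf_eq0 eq_le h0 sqr_ge0.
have [A1 A2] : ulsubmx A - 1%:M = 0 /\ ursubmx A = 0.
  apply: sqrt2_mx_free; have := emb_upper AQ;
    rewrite k1 mulmx1 -{1}[hscale]mul1mx.
  move/(can_inj (mulmxK hscale_unit));
    rewrite -map_ulsubmx -map_ursubmx scaleNr => E.
  by rewrite map_mxB map_mx1 addrAC -E subrr.
have h1 : h = 1%:M.
  have := emb_upper AP; rewrite -map_ulsubmx -map_ursubmx A2.
  move/eqP: A1; rewrite subr_eq0 => /eqP ->.
  rewrite map_mx1 map_mx0 scaler0 addr0 mul1mx =>
    /(congr1 (mulmx (invmx hscale))).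
  by rewrite mulKmx ?mulVmx ?hscale_unit.
by apply: hacts1; rewrite -h1.
Qed.

(** * Finiteness of the reduced data, and cocompactness *)

Definition emb_linv : 'M[R]_(N, N + N) := row_mx (invmx hscale) 0.

Lemma emb_linvP : emb_linv *m P = 1%:M.
Proof. by rewrite /emb_linv /embP mul_row_col mul0mx addr0 mulVmx ?hscale_unit.
  Qed.

Lemma emb_linvQ : emb_linv *m Q = 1%:M.
Proof. by rewrite /emb_linv /embQ mul_row_col mul0mx addr0 mulVmx ?hscale_unit.
  Qed.

Lemma hJ_unit : hJ \in unitmx.
Proof. by have [] := mulmx1_unit (@hJK R d). Qed.

Lemma gram_entry (A U : 'M[int]_(N + N)) i j :
  (U *m A *m U^T) i j = iform A (row i U) (row j U).
Proof.
rewrite /iform -row_mul [LHS]mxE [RHS]mxE; apply: eq_bigr => k _.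
by rewrite [in RHS]mxE; congr (_ * _); rewrite !mxE.
Qed.

(** Cauchy-Schwarz bounds both conjugates [x + sqrt 2 y] and [x - sqrt 2 y] of a Gram entry, hence
    [x] and [y]. *)
Lemma gram_bound (g : 'M[R]_N) (U : 'M[int]_(N + N)) (C : R) : lorentzian g ->
  (forall i, dot (row i (toR U *m P *m g)) (row i (toR U *m P *m g)) +
    dot (row i (toR U *m Q)) (row i (toR U *m Q)) <= C) ->
  forall i j, `|(U *m Phi1 *m U^T) i j|%:~R <=
    C /\ `|(U *m Phi2 *m U^T) i j|%:~R <= C.
Proof.
move=> hg UC i j; rewrite !gram_entry.
have C0 : 0 <= C by apply: le_trans (UC i); rewrite addr_ge0 ?dot_ge0.
have pC l : dot (row l (toR U *m P *m g)) (row l (toR U *m P *m g)) <= C.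
  by apply: le_trans (UC l); rewrite lerDl dot_ge0.
have qC l : dot (row l (toR U *m Q)) (row l (toR U *m Q)) <= C.
  by apply: le_trans (UC l); rewrite lerDr dot_ge0.
have sC (x : R) : x ^+ 2 <= C * C -> `|x| <= C.
  by move=> xC; rewrite -[leRHS]ger0_norm// -!sqrtr_sqr ler_wsqrtr.
have h1 : `|lform (toR (row i U) *m P) (toR (row j U) *m P)| <= C.
  apply: sC; rewrite -(lform_lorentzian _ _ hg);
    apply: le_trans (lform_CS _ _) _.
  by apply: ler_pM (dot_ge0 _) (dot_ge0 _) _ _; rewrite map_row -!row_mul.
have h2 : `|dot (toR (row i U) *m Q) (toR (row j U) *m Q)| <= C.
  apply: sC; apply: le_trans (dot_CS _ _) _.
  by apply: ler_pM (dot_ge0 _) (dot_ge0 _) _ _; rewrite map_row -!row_mul.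
move: h1 h2; rewrite lform_embP dot_embQ.
move: (iform _ _ _) (iform _ _ _) => a b.
rewrite !intr_norm; move: (a%:~R : R) (b%:~R : R) => y x.
have s1 : 1 <= s2.
  by rewrite -[leLHS]sqrtr1 ler_wsqrtr// ler1n.
rewrite !ler_norml => /andP[h1 h2] /andP[h3 h4].
have : `|s2 * y| <= C by rewrite ler_norml; apply/andP; split; lra.
rewrite normrM (ger0_norm (sqrtr_ge0 _)) => sy.
split; first by apply/andP; split; lra.
rewrite -ler_norml; apply: le_trans sy.
by rewrite ler_peMl.
Qed.

(** [A] preserves both combinations [Phi1 + sqrt 2 Phi2] and [Phi1 - sqrt 2 Phi2], so it descends
    along each embedding. *)
Lemma form_preserving (A : 'M[int]_(N + N)) : A \in unitmx ->
  A *m Phi1 *m A^T = Phi1 -> A *m Phi2 *m A^T = Phi2 ->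
  exists h k, [/\ toR A *m P = P *m h, toR A *m Q = Q *m k,
    lorentzian h & k *m k^T = 1%:M].
Proof.
move=> uA A1 A2; have uAR := unit_toR (R := R) uA.
have R1 : toR A *m toR Phi1 *m (toR A)^T = toR Phi1.
  by rewrite map_trmx -!map_mxM A1.
have R2 : toR A *m toR Phi2 *m (toR A)^T = toR Phi2.
  by rewrite map_trmx -!map_mxM A2.
have [|h Ph hh] := descend_isometry emb_linvP hJ_unit uAR.
  by rewrite embP_form mulmxDr mulmxDl -scalemxAr -scalemxAl R1 R2.
have [|k Qk kk] := descend_isometry emb_linvQ (unitmx1 _ _) uAR.
  by rewrite mulmx1 embQ_form mulmxBr mulmxBl -scalemxAr -scalemxAl R1 R2.
by exists h, k; split => //; rewrite -{1}[k]mulmx1.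
Qed.

Definition code_int (M : nat) (z : int) : 'I_(2 * M).+1 := inord `|z + M%:Z|.

Lemma code_int_inj M z z' : (`|z| <= M)%N -> (`|z'| <= M)%N ->
  code_int M z = code_int M z' -> z = z'.
Proof. by move=> zM z'M /(congr1 val); rewrite /= !inordK; lia. Qed.

Definition code_mod (m : nat) (z : int) : 'I_m.+1 := inord `|(z %% m.+1%:Z)%Z|.

Lemma code_mod_eq m z z' : code_mod m z = code_mod m z' ->
  exists w, z' = z + m.+1%:Z * w.
Proof.
have zm (u : int) : 0 <= (u %% m.+1%:Z)%Z < m.+1%:Z.
  by rewrite modz_ge0//= ltz_pmod.
move/(congr1 val); have := zm z; have := zm z' => h1 h2.
rewrite /= !inordK; [|lia..] => E.
exists ((z' %/ m.+1%:Z)%Z - (z %/ m.+1%:Z)%Z).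
have := divz_eq z m.+1%:Z; have := divz_eq z' m.+1%:Z; lia.
Qed.

Lemma congruence_group_cocompact m :
  cocompact (X := H : metricType R) (congruence_group m.+1).
Proof.
have [p0 p0E] := @horigin_point R d.
have [C HC] := emb_basis_reduced.
have /choice[U UP] : forall p : H, exists U : 'M[int]_(N + N), U \in unitmx /\
    forall i, dot (row i (toR U *m P *m midreflection p)) (row i (toR U *m P *m
      midreflection p)) +
    dot (row i (toR U *m Q)) (row i (toR U *m Q)) <= C.
  by move=> p; have [U uU UC] := HC _ (midreflection_lorentzian p); exists U.
pose M := `|Num.floor C|%N.
have CM (z : int) : `|z|%:~R <= C -> (`|z| <= M)%N.
  rewrite -floor_ge_int /M; move: (Num.floor C) => c; lia.
pose code p := (map_mx (code_int M) (U p *m Phi1 *m (U p)^T),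
  map_mx (code_int M) (U p *m Phi2 *m (U p)^T), map_mx (code_mod m) (U p)).
pose near c r := forall p, code p = c ->
  exists2 g, congruence_group m.+1 g & hdist p0 (g p) <= r.
suff /choice[r rP] : forall c, exists r : R, near c r.
  (* There are finitely many codes, so the sum dominates the radius found for each of them. *)
  exists p0, (\sum_c `|r c|) => p; have [g Gg gr] := rP (code p) p erefl.
  exists g => //; apply: le_trans gr _; apply: le_trans (ler_norm _) _.
  by rewrite (bigD1 (code p))//= lerDl sumr_ge0.
move=> c; have [[p' p'c]|nop] := pselect (exists p, code p = c); last first.
  by exists 0 => p pc; exfalso; apply: nop; exists p.
have [uU' UC'] := UP p'; have uUR' := unit_toR (R := R) uU'.
(* [W] recovers a vector from its Lorentz products with the basis chosen for [p']. In [r], the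
   summand 1 turns a bound on [x^2] into one on [x]. *)
pose W := hJ *m emb_linv *m invmx (toR (U p')).
pose r := 1 + dot (row 0 W) (row 0 W) * ((N + N)%:R * C).
exists (ln (2 * r)) => p;
  rewrite -p'c => -[/matrixP c1 /matrixP c2 /matrixP c3].
have [uU UC] := UP p; have uUR := unit_toR (R := R) uU.
have b := gram_bound (midreflection_lorentzian p) UC.
have b' := gram_bound (midreflection_lorentzian p') UC'.
have G1 : U p *m Phi1 *m (U p)^T = U p' *m Phi1 *m (U p')^T.
  apply/matrixP => i j; have := c1 i j; rewrite [LHS]mxE [RHS]mxE.
  by apply: code_int_inj; apply: CM; [exact: (b i j).1|exact: (b' i j).1].
have G2 : U p *m Phi2 *m (U p)^T = U p' *m Phi2 *m (U p')^T.
  apply/matrixP => i j; have := c2 i j; rewrite [LHS]mxE [RHS]mxE.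
  by apply: code_int_inj; apply: CM; [exact: (b i j).2|exact: (b' i j).2].
have [Z UZ] : exists Z, U p' = U p + m.+1%:Z *: Z.
  have /choice[z zP] : forall ij, exists w, U p' ij.1 ij.2 =
    U p ij.1 ij.2 + m.+1%:Z * w.
    by move=> [i j]; apply: code_mod_eq; have := c3 i j;
      rewrite [LHS]mxE [RHS]mxE.
  exists (\matrix_(i, j) z (i, j)); apply/matrixP => i j.
  by rewrite !mxE; exact: (zP (i, j)).
(* The change between the two reduced bases preserves both Gram matrices and is 1 modulo [m + 1],
   since the codes agree. *)
pose A := invmx (U p) *m U p'.
have uA : A \in unitmx by rewrite unitmx_mul unitmx_inv uU.
have UA : U p *m A = U p' by rewrite /A mulKVmx.
have Apres (F : 'M[int]_(N + N)) : U p *m F *m (U p)^T =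
  U p' *m F *m (U p')^T ->
    A *m F *m A^T = F.
  rewrite -UA trmx_mul => E; apply: (can_inj (mulKmx uU)).
  apply: (can_inj (mulmxK (_ : (U p)^T \in unitmx)));
    first by rewrite unitmx_tr.
  by rewrite E !mulmxA.
have [h [k [AP AQ hh kk]]] := form_preserving uA (Apres _ G1) (Apres _ G2).
have [g hg] := hacts_exists hh.
exists g.
  exists A, (invmx (U p) *m Z), h, k; split => //.
  by rewrite /A UZ mulmxDr mulVmx// -scalemxAr.
set q := hvec (g p).
pose v := toR (U p') *m P *m hJ *m q^T.
(* Up to sign, the products of [g p] with the basis of [p'] are those of [p] with its own reduced
   basis; these are bounded because the reduction is relative to the Euclidean structure that moves
   [p] to the origin. *)
have vC i : v i 0 ^+ 2 <= C.
  have -> : v i 0 = lform (row i (toR (U p') *m P)) q.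
    rewrite /lform dot_mxE -!row_mul !mxE //.
  have -> : lform (row i (toR (U p') *m P)) q ^+ 2 =
    lform (row i (toR (U p) *m P)) (hvec p) ^+ 2.
    have -> : row i (toR (U p') *m P) = row i (toR (U p) *m P) *m h.
      by rewrite -UA map_mxM -!row_mul -!mulmxA AP.
    by rewrite /q; case: (hg p) => ->; rewrite ?lformNr ?sqrrN lform_lorentzian.
  rewrite -(lform_lorentzian _ _ (midreflection_lorentzian p))
    hvec_midreflection.
  apply: le_trans (lform_CS _ _) _.
  have -> : dot (@horigin R d) horigin = 1.
    by rewrite dot_row_mx dot_scalar (_ : dot 0 0 =
      0) ?addr0 ?mulr1// -(scale0r 0) dotZl mul0r.
  by rewrite mulr1 -row_mul; apply: le_trans (UC i); rewrite lerDl dot_ge0.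
have qW : q^T = W *m v.
  rewrite /W /v !mulmxA mulmxKV// -[hJ *m emb_linv *m P]mulmxA emb_linvP.
  by rewrite mulmx1 hJK mul1mx.
apply: hdist_le_ln; rewrite p0E lform_origin_hvec opprK -/q.
have -> : q 0 0 = dot (row 0 W) v^T.
  have := congr1 (fun X : 'cV_N => X 0 0) qW; rewrite mxE => ->.
  by rewrite mxE; apply: eq_bigr => i _; rewrite !mxE.
set x := dot _ _.
have x2 : x ^+ 2 <= dot (row 0 W) (row 0 W) * ((N + N)%:R * C).
  apply: le_trans (dot_CS _ _) _; rewrite ler_wpM2l ?dot_ge0//.
  have -> : (N + N)%:R * C =
    \sum_(i < N + N) C by rewrite sumr_const card_ord mulr_natl.
  apply: ler_sum => i _; have -> : v^T 0 i = v i 0 by rewrite mxE.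
  by rewrite -expr2.
by have := sqr_ge0 (x - 1); rewrite /r; move: x2; rewrite !expr2; nra.
Qed.

Lemma hyperbolic_deck (D : R) : exists2 Gam : set (H -> H),
  isometry_group (X := H : metricType R) Gam &
  cocompact (X := H : metricType R) Gam /\ displaces (X := H :
    metricType R) Gam D.
Proof.
have [m mD] := congruence_group_displaces D.
exists (congruence_group m.+1); first exact: congruence_group_isometry.
by split => //; exact: congruence_group_cocompact.
Qed.

End ArithmeticLattice.

Theorem theorem1p2 (R : realType) (d : nat) (X : metricType R)
    (hX : X = (euclidean R d : metricType R) \/
          X = (hyperbolic R d : metricType R))
    (K : set X) (hK : body K) (n : nat) (hn : (1 <= n)%N) :
  (exists (I : Type) (F : I -> set X),
      packing_with K F /\ n_saturated n K F) /\
  (exists (I : Type) (F : I -> set X),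
      covering_with K F /\ n_reduced n K F).
Proof.
case: hX K hK => -> K hK; apply: saturated_packing_reduced_covering => //.
- exact: euclidean_transitive.
- exact: euclidean_separated.
- exact: euclidean_deck.
- exact: hyperbolic_transitive.
- exact: hyperbolic_separated.
- exact: hyperbolic_deck.
Qed.
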